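(* Let $\lambda_{ij}\ge0$ ($i,j=1,\dots,k$, $i\ne j$) be fixed, and suppose that for any control value $x$ $$\{y:f_{\theta_1}(y|x)=0\}\subset\bigcap_{i>1}\{y:f_{\theta_i}(y|x)=0\}.$$ If there exists a strategy $(\chi,\psi)\in\mathscr F$ such that $$L(\chi,\psi)=\inf_{(\chi',\psi')\in\mathscr F}L(\chi',\psi'),\qquad(\ast)$$ then the following hold: (a) for any $r=1,2,\dots$, $$I_{\{g(Z_r^\chi)<1+R(Z_r^\chi)\}}\le\psi_r^\chi\le I_{\{g(Z_r^\chi)\le1+R(Z_r^\chi)\}}$$ $P_{\theta_1}^\chi$-almost surely on $\{y^{(r)}:(1-\psi_1^\chi(y^{(1)}))\cdots(1-\psi_{r-1}^\chi(y^{(r-1)}))>0\}$; (b) for any $r=1,2,\dots$, $$\int f_{\theta_1}(y|\chi_{r+1})\,\rho\!\left(Z_r^{2,\chi}\frac{f_{\theta_2}(y|\chi_{r+1})}{f_{\theta_1}(y|\chi_{r+1})},\dots,Z_r^{k,\chi}\frac{f_{\theta_k}(y|\chi_{r+1})}{f_{\theta_1}(y|\chi_{r+1})}\right)d\mu(y)=R(Z_r^\chi)$$ $P_{\theta_1}^\chi$-almost surely on $\{y^{(r)}:(1-\psi_1^\chi(y^{(1)}))\cdots(1-\psi_r^\chi(y^{(r)}))>0\}$; (c) $\chi_1$ is such that $$\int f_{\theta_1}(y|\chi_1)\,\rho\!\left(\frac{f_{\theta_2}(y|\chi_1)}{f_{\theta_1}(y|\chi_1)},\dots,\frac{f_{\theta_k}(y|\chi_1)}{f_{\theta_1}(y|\chi_1)}\right)d\mu(y)=R(1),$$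 where $R(1)$ is the value of $R$ at $z=(1,\dots,1)$. On the other hand, if $(\chi,\psi)$ satisfies (a), (b) and (c), and $(\chi,\psi)\in\mathscr F$, then $(\chi,\psi)$ satisfies $(\ast)$.
   Context: Model. There are $k\ge 2$ simple hypotheses $H_i:\theta=\theta_i$, $i=1,\dots,k$. A control variable takes values in a measurable space $\mathcal X$; observations take values in a measurable space $\mathcal Y$ with a $\sigma$-finite measure $\mu$. Under parameter $\theta$ and control $x$, an observation has density $f_\theta(y|x)$ with respect to $\mu$. Given controls $x_1,\dots,x_n$, the observations are independent, with joint density $f_\theta^n=f_\theta^n(x^{(n)},y^{(n)})=\prod_{i=1}^n f_\theta(y_i|x_i)$ with respect to $\mu^n=\mu\otimes\cdots\otimes\mu$. Here $x^{(n)}=(x_1,\dots,x_n)$, $y^{(n)}=(y_1,\dots,y_n)$. Strategies. A strategy $(\chi,\psi)$ consists of a control policy $\chi=(\chi_1,\chi_2,\dots)$ of measurable functions $\chi_n=\chi_n(x^{(n-1)},y^{(n-1)})$ with values in $\mathcal X$ ($\chi_1$ is a fixed element of $\mathcal X$), and a stopping rule $\psi=(\psi_1,\psi_2,\dots)$ of measurable functions $\psi_n=\psi_n(x^{(n)},y^{(n)})\in[0,1]$ (conditional probability of stopping at stage $n$ given that stage $n$ is reached). At each stage the control $x_n=\chi_n(x^{(n-1)},y^{(n-1)})$ is applied and then $y_n$ is observed. Notation. For $F_n=F_n(x^{(n)},y^{(n)})$, $F_n^\chi(y^{(n)})$ denotes $F_n(x^{(n)},y^{(n)})$ with $x_i=\chi_i(x^{(i-1)},y^{(i-1)})$,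 $i=1,\dots,n$; $f_\theta^{n,\chi}$ is the density of $Y^{(n)}$ under $\theta$ and $\chi$ (whose law is $P_\theta^\chi$), and $E_\theta^\chi F_n=\int F_n^\chi f_\theta^{n,\chi}d\mu^n$. In (b), $\chi_{r+1}$ stands for the control value $x_{r+1}$ produced by the policy $\chi$ after observing $y^{(r)}$. $I_A$ is the indicator of $A$. The stopping time $\tau_\psi$ satisfies $P_\theta^\chi(\tau_\psi=n)=E_\theta^\chi(1-\psi_1)\cdots(1-\psi_{n-1})\psi_n$. For $r=1$ the set in (a) is the whole space of $y^{(1)}$. Objective. $l_n=\min_{1\le j\le k}\sum_{i\ne j}\lambda_{ij}f_{\theta_i}^n$, and $$L(\chi,\psi)=\sum_{n=1}^\infty\int (1-\psi_1^\chi)\cdots(1-\psi_{n-1}^\chi)\psi_n^\chi\left(nf_{\theta_1}^{n,\chi}+l_n^\chi\right)d\mu^n\ \text{ if }P_{\theta_1}^\chi(\tau_\psi<\infty)=1,\qquad L(\chi,\psi)=\infty\ \text{ otherwise.}$$ Class. $\mathscr F$ is the set of all strategies $(\chi,\psi)$ with $\lim_{n\to\infty}E_{\theta_i}^\chi(1-\psi_1)\cdots(1-\psi_n)=0$ for every $i=1,\dots,k$. Likelihood ratios and $\rho$. $Z_n^r=Z_n^r(x^{(n)},y^{(n)})=\prod_{i=1}^n\frac{f_{\theta_r}(y_i|x_i)}{f_{\theta_1}(y_i|x_i)}$ for $r=2,\dots,k$, and $Z_n=(Z_n^2,\dots,Z_n^k)$. For $z=(z_2,\dots,z_k)$ with nonnegative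 components, and with $z_1\equiv1$, let $\rho_0(z)=g(z)=\min_{j}\sum_{i\ne j}\lambda_{ij}z_i$ (the minimum over $j=1,\dots,k$), and for $r=1,2,\dots$ $$\rho_r(z)=\min\left\{g(z),\,1+\min_x\int f_{\theta_1}(y|x)\rho_{r-1}\!\left(z_2\tfrac{f_{\theta_2}(y|x)}{f_{\theta_1}(y|x)},\dots,z_k\tfrac{f_{\theta_k}(y|x)}{f_{\theta_1}(y|x)}\right)d\mu(y)\right\}.$$ The sequence $\rho_r$ is non-increasing in $r$; $\rho(z)=\lim_{r\to\infty}\rho_r(z)$ and $$R(z)=\min_x\int f_{\theta_1}(y|x)\rho\!\left(z_2\tfrac{f_{\theta_2}(y|x)}{f_{\theta_1}(y|x)},\dots,z_k\tfrac{f_{\theta_k}(y|x)}{f_{\theta_1}(y|x)}\right)d\mu(y).$$ Standing assumption: all these functions defined by minima over the control are well-defined (minima attained) and measurable. *)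

(* Defs.v *)
From HB Require Import structures.
From mathcomp Require Import all_boot all_order all_algebra.
From mathcomp Require Import all_classical all_reals all_analysis.
From mathcomp Require Import measurable_realfun.

Set Implicit Arguments.
Unset Strict Implicit.
Unset Printing Implicit Defensive.
Import Order.TTheory GRing.Theory Num.Theory.
Import numFieldNormedType.Exports.

Local Open Scope classical_set_scope.
Local Open Scope ring_scope.
Local Open Scope ereal_scope.

Definition tprefix (T : Type) (n : nat) (t : n.+1.-tuple T) : n.-tuple T :=
  [tuple tnth t (widen_ord (leqnSn n) i) | i < n].

Definition snoc (T : Type) (n : nat) (p : n.-tuple T * T) : n.+1.-tuple T :=
  rcons_tuple p.1 p.2.

Lemma measurable_snoc d (T : measurableType d) (n : nat) :
  measurable_fun [set: n.-tuple T * T] (@snoc T n).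
Proof.
apply/measurable_fun_tnthP => i.
have [lt_in|le_ni] := ltnP i n.
  have -> : @tnth _ T ^~ i \o @snoc T n =
            (fun t => tnth t (Ordinal lt_in)) \o fst.
    apply/funext => -[t a] /=.
    by rewrite !(tnth_nth a) /= nth_rcons size_tuple lt_in.
  by apply: measurableT_comp; [exact: measurable_tnth|exact: measurable_fst].
have -> : @tnth _ T ^~ i \o @snoc T n = snd.
  apply/funext => -[t a] /=.
  have -> : i = ord_max.
    by apply/val_inj/eqP; rewrite eqn_leq le_ni -ltnS ltn_ord.
  by rewrite (tnth_nth a) /= nth_rcons size_tuple ltnn eqxx.
exact: measurable_snd.
Qed.

Section snoc_measure.
Context {R : realType} d (T : measurableType d) (n : nat).
Variables (M : {measure set (n.-tuple T) -> \bar R}).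
Variables (mu : {sigma_finite_measure set T -> \bar R}).

Definition snoc_measure : set (n.+1.-tuple T) -> \bar R :=
  pushforward (M \x mu) (@snoc T n).

Let mP := measure_function_pushforward__canonical__measure_function_Measure
  (M \x mu) (@measurable_snoc d T n).

HB.instance Definition _ := isMeasure.Build _ _ _ snoc_measure
  (measure0 mP) (measure_ge0 mP) (@measure_semi_sigma_additive _ _ _ mP).

End snoc_measure.

Section model.
Context {R : realType} {dX dY : measure_display}.
Context {X : measurableType dX} {Y : measurableType dY}.

(* The product measure mu^n on Y^n; mu^0 is the unit mass on the one-point
   space Y^0. *)
Fixpoint powm (mu : {sigma_finite_measure set Y -> \bar R}) (n : nat) :
    {measure set (n.-tuple Y) -> \bar R} :=
  match n return {measure set (n.-tuple Y) -> \bar R} with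
  | 0 => dirac [tuple]
  | n'.+1 => snoc_measure (powm mu n') mu
  end.

Definition history (n : nat) : Type := (n.-tuple X * n.-tuple Y)%type.

Definition hprefix (n : nat) (h : history n.+1) : history n :=
  (tprefix h.1, tprefix h.2).

(* Indices are shifted by one: [chi s n] is the (n+1)-st control function,
   evaluated on the history of the first n stages, and [psi s n] is the
   probability of stopping at stage n+1. *)
Record strategy := Strategy {
  chi : forall n : nat, n.-tuple X * n.-tuple Y -> X ;
  psi : forall n : nat, n.+1.-tuple X * n.+1.-tuple Y -> R ;
  measurable_chi : forall n, measurable_fun setT (@chi n) ;
  measurable_psi : forall n, measurable_fun setT (@psi n) ;
  psi_ge0 : forall n h, (0 <= @psi n h)%R ;
  psi_le1 : forall n h, (@psi n h <= 1)%R }.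

Fixpoint controls (s : strategy) (n : nat) : n.-tuple Y -> n.-tuple X :=
  match n return n.-tuple Y -> n.-tuple X with
  | 0 => fun=> [tuple]
  | n'.+1 => fun y => let x' := controls s (tprefix y) in
                      rcons_tuple x' (chi s (x', tprefix y))
  end.

(* [F (hist s y)] is F_n^chi (y^(n)). *)
Definition hist (s : strategy) (n : nat) (y : n.-tuple Y) : history n :=
  (controls s y, y).

(* (1 - psi_1) ... (1 - psi_n) *)
Fixpoint surv (s : strategy) (n : nat) : history n -> R :=
  match n return history n -> R with
  | 0 => fun=> 1%R
  | n'.+1 => fun h => (surv s (hprefix h) * (1 - psi s h))%R
  end.

(* (1 - psi_1) ... (1 - psi_n) psi_{n+1} *)
Definition stop (s : strategy) (n : nat) (h : history n.+1) : R :=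
  (surv s (hprefix h) * psi s h)%R.

(* The hypotheses H_1, ..., H_k are indexed by 'I_k with k = m.+1; H_1 is
   [ord0], and the r-th of the remaining m ones is [lift ord0 r]. *)
Context {m : nat}.
Variables (mu : {sigma_finite_measure set Y -> \bar R}).
Variables (f : 'I_m.+1 -> X -> Y -> R) (lambda : 'I_m.+1 -> 'I_m.+1 -> R).

Definition is_density (p : X -> Y -> R) : Prop :=
  [/\ measurable_fun setT (fun xy : X * Y => p xy.1 xy.2),
      forall x y, (0 <= p x y)%R
    & forall x, \int[mu]_y (p x y)%:E = 1].

Definition jdens (i : 'I_m.+1) (n : nat) (h : history n) : R :=
  (\prod_(j < n) f i (tnth h.1 j) (tnth h.2 j))%R.

(* min_j sum_(i != j) lambda_ij v_i *)
Definition minrisk (v : 'I_m.+1 -> R) : R :=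
  let c j := (\sum_(i < m.+1 | i != j) lambda i j * v i)%R in
  \big[Order.min/c ord0]_(j < m.+1) c j.

Definition lrisk (n : nat) (h : history n) : R := minrisk (fun i => jdens i h).

Definition Echi (s : strategy) (i : 'I_m.+1) (n : nat) (F : history n -> R) :
    \bar R :=
  \int[powm mu n]_y (F (hist s y) * jdens i (hist s y))%:E.

Definition law (s : strategy) (i : 'I_m.+1) (n : nat) (A : set (n.-tuple Y)) :
    \bar R :=
  \int[powm mu n]_(y in A) (jdens i (hist s y))%:E.

Definition prob_tau_fin (s : strategy) (i : 'I_m.+1) : \bar R :=
  \sum_(0 <= n <oo) Echi s i (@stop s n).

Definition Lcost (s : strategy) : \bar R :=
  if `[< prob_tau_fin s ord0 = 1 >] then
    \sum_(0 <= n <oo) \int[powm mu n.+1]_y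
      (stop s (hist s y) *
        (n.+1%:R * jdens ord0 (hist s y) + lrisk (hist s y)))%:E
  else +oo.

Definition classF : set strategy :=
  [set s | forall i, Echi s i (@surv s n) @[n --> \oo] --> 0].

Definition optimal (s : strategy) : Prop :=
  Lcost s = ereal_inf [set Lcost t | t in classF].

Definition LR (n : nat) (h : history n) : m.-tuple R :=
  [tuple (\prod_(i < n) (f (lift ord0 r) (tnth h.1 i) (tnth h.2 i)
                         / f ord0 (tnth h.1 i) (tnth h.2 i)))%R | r < m].

(* z stands for (z_2, ..., z_k); [cons_tuple] puts z_1 = 1 in front. *)
Definition g (z : m.-tuple R) : R := minrisk (tnth (cons_tuple 1%R z)).

(* Where f_(theta_1) vanishes the quotient is 0 by convention; in [step] such
   points have zero weight. *)
Definition update (x : X) (y : Y) (z : m.-tuple R) : m.-tuple R :=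
  [tuple (tnth z r * (f (lift ord0 r) x y / f ord0 x y))%R | r < m].

Definition step (h : m.-tuple R -> \bar R) (z : m.-tuple R) (x : X) : \bar R :=
  \int[mu]_y ((f ord0 x y)%:E * h (update x y z)).

(* An infimum, hence the minimum whenever [attains_min] holds. *)
Definition min_ctrl (c : X -> \bar R) : \bar R := ereal_inf (range c).

Definition attains_min (c : X -> \bar R) : Prop :=
  exists x0, forall x, c x0 <= c x.

Fixpoint rho_ (r : nat) (z : m.-tuple R) : \bar R :=
  match r with
  | 0 => (g z)%:E
  | r'.+1 => Order.min (g z)%:E (1 + min_ctrl (step (rho_ r') z))
  end.

Definition rho (z : m.-tuple R) : \bar R := limn (fun r => rho_ r z).

Definition Rfun (z : m.-tuple R) : \bar R := min_ctrl (step rho z).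

Definition nonneg_tuple : set (m.-tuple R) :=
  [set z | forall r, (0 <= tnth z r)%R].

Definition minima_well_defined : Prop :=
  [/\ forall r z, nonneg_tuple z -> attains_min (step (rho_ r) z),
      forall z, nonneg_tuple z -> attains_min (step rho z),
      forall r, measurable_fun nonneg_tuple (rho_ r)
    & measurable_fun nonneg_tuple Rfun].

Definition cond_a (s : strategy) : Prop :=
  forall r : nat, {ae law s ord0 (n := r.+1), forall y,
    (0 < surv s (hist s (tprefix y)))%R ->
    (\1_[set v : r.+1.-tuple Y |
           ((g (LR (hist s v)))%:E < 1 + Rfun (LR (hist s v)))%E] y
       <= psi s (hist s y)
       <= \1_[set v : r.+1.-tuple Y |
           ((g (LR (hist s v)))%:E <= 1 + Rfun (LR (hist s v)))%E] y)%R}.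

Definition cond_b (s : strategy) : Prop :=
  forall r : nat, (0 < r)%N -> {ae law s ord0 (n := r), forall y,
    (0 < surv s (hist s y))%R ->
    step rho (LR (hist s y)) (chi s (hist s y)) = Rfun (LR (hist s y))}.

Definition cond_c (s : strategy) : Prop :=
  step rho [tuple 1%R | r < m] (@chi s 0 ([tuple], [tuple]))
    = Rfun [tuple 1%R | r < m].

End model.

Arguments strategy R {dX dY} X Y.

(* Main.v *)
(* Under theta_1 the terminal risk is g(Z_n), so the cost of a strategy is the
   expected number of observations plus E g(Z_tau). Let A_n be the expected cost
   when the strategy is followed through n decisions and the rest of the risk is
   replaced by rho. Since rho = min(g, 1 + R), the sequence A_n is nondecreasing,
   and A_n = A_(n+1) exactly when (a) at stage n+1 and (b) after stage n+1 hold
   almost surely; moreover A_0 >= 1 + R(1), with equality exactly under (c). In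
   the class F the remaining risk, bounded by a multiple of
   sum_i E_i (1 - psi_1)...(1 - psi_n), tends to 0, so A_n tends to the cost. Hence
   the cost is at least 1 + R(1), with equality exactly under (a), (b) and (c).

   It remains to see that 1 + R(1) is the infimum over F. The functions rho_r and
   the one-step expectations of rho_r are Lipschitz in z, uniformly in the
   control, so near-optimal controls can be taken piecewise constant on a grid;
   the truncated strategies built from them have cost close to
   1 + min_x int f_1 rho_N, which tends to 1 + R(1). *)
From HB Require Import structures.
Require Import Defs.
From mathcomp Require Import all_boot all_order all_algebra.
From mathcomp Require Import all_classical all_reals all_analysis.
From mathcomp Require Import measurable_realfun ring lra.
Import Order.TTheory GRing.Theory Num.Theory.
Import numFieldNormedType.Exports.

Set Implicit Arguments.
Unset Strict Implicit.
Unset Printing Implicit Defensive.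

Local Open Scope classical_set_scope.
Local Open Scope ring_scope.

(** * Tuples and the powers of mu *)

Section tuples.
Context {T : Type} {n : nat}.

Lemma tnth_rcons_ord_max (t : n.-tuple T) (a : T) :
  tnth (rcons_tuple t a) ord_max = a.
Proof. by rewrite (tnth_nth a) /= nth_rcons size_tuple ltnn eqxx. Qed.

Lemma tnth_rcons_widen (t : n.-tuple T) (a : T) (i : 'I_n) :
  tnth (rcons_tuple t a) (widen_ord (leqnSn n) i) = tnth t i.
Proof. by rewrite !(tnth_nth a) /= nth_rcons size_tuple ltn_ord. Qed.

Lemma tprefix_rcons (t : n.-tuple T) (a : T) : tprefix (rcons_tuple t a) = t.
Proof.
by apply: eq_from_tnth => i; rewrite tnth_mktuple tnth_rcons_widen.
Qed.

Lemma tprefix_snoc (t : n.-tuple T) (a : T) : tprefix (snoc (t, a)) = t.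
Proof. exact: tprefix_rcons. Qed.

End tuples.

Lemma measurable_tprefix d (T : measurableType d) (n : nat) :
  measurable_fun [set: n.+1.-tuple T] (@tprefix T n).
Proof.
apply/measurable_fun_tnthP => i.
rewrite (_ : _ \o _ = fun t => tnth t (widen_ord (leqnSn n) i)).
  exact: measurable_tnth.
by apply/funext => t /=; rewrite tnth_mktuple.
Qed.

Lemma measurable_nonneg_tuple (R : realType) (m : nat) :
  measurable (@nonneg_tuple R m).
Proof.
rewrite (_ : nonneg_tuple =
    \bigcap_(i in [set: 'I_m]) ((fun z => tnth z i) @^-1` `[0, +oo[%classic)).
  apply: fin_bigcap_measurable => // i _; rewrite -[X in measurable X]setTI.
  by apply: measurable_tnth => //; exact: measurable_itv.
apply/seteqP; split => z z0 i.
  by move=> _; rewrite /= in_itv /= andbT; exact: z0.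
by have := z0 i I; rewrite /= in_itv /= andbT.
Qed.

Section sigma_finite_factor.
Local Open Scope ereal_scope.
Context {R : realType} {d d' : measure_display}.
Context {T : measurableType d} {T' : measurableType d'}.
Variables (M : {measure set T -> \bar R}) (sM : sigma_finite setT M).
Variable mu : {sigma_finite_measure set T' -> \bar R}.

(** [powm mu n] is declared only as a measure, and its sigma-finiteness comes as a separate proof.
    Packing that proof with the measure makes Tonelli's theorem applicable. *)
Let H1 := isSFinite.Build _ _ _ _ (sfinite_measure_sigma_finite sM).
Let H2 := isSigmaFinite.Build _ _ _ _ sM.
Let P : {sigma_finite_measure set T -> \bar R} :=
  HB.pack_for (sigma_finite_measure T R) (Measure.sort M) H1 H2.

Lemma sigma_finite_product_measure1 : sigma_finite setT (M \x mu).
Proof.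
have /sigma_finiteP[A [TA ndA finA]] := sM.
have /sigma_finiteP[B [TB ndB finB]] := sigma_finiteT mu.
(* Both exhausting sequences increase, so a point with coordinates in [A i] and [B j] lies in the
   product of index [maxn i j]. *)
exists (fun k => A k `*` B k).
  apply/esym; rewrite -subTset => -[x y] _.
  have [i _ Aix] : (\bigcup_i A i) x by rewrite -TA.
  have [j _ Bjy] : (\bigcup_i B i) y by rewrite -TB.
  exists (maxn i j) => //; split => /=.
    by move: Aix; apply/subsetPset/ndA/leq_maxl.
  by move: Bjy; apply/subsetPset/ndB/leq_maxr.
move=> k; have [mA Ak] := finA k; have [mB Bk] := finB k.
split; first exact: measurableX.
by rewrite product_measure1E// lte_mul_pinfty// ge0_fin_numE.
Qed.

Lemma sigma_finite_fubini_tonelli1 (F : T * T' -> \bar R) :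
  measurable_fun setT F -> (forall u, 0 <= F u) ->
  \int[M \x mu]_u F u = \int[M]_x \int[mu]_y F (x, y).
Proof. exact: (@fubini_tonelli1 _ _ _ _ _ P mu F). Qed.

End sigma_finite_factor.

Section power_measure.
Local Open Scope ereal_scope.
Context {R : realType} {d : measure_display} {Y : measurableType d}.
Variable mu : {sigma_finite_measure set Y -> \bar R}.

Lemma sigma_finite_powm n : sigma_finite setT (powm mu n).
Proof.
elim: n => [|n IHn].
  apply: fin_num_fun_sigma_finite; first by rewrite measure0.
  by move=> A mA; rewrite /= diracE.
have [F [FT Ffin]] := sigma_finite_product_measure1 IHn mu.
(* The cover of the product is transported along the inverse of [snoc]. *)
exists (fun i => [set t | F i (tprefix t, tnth t ord_max)]).
  by rewrite predeqE => t; split => // _; have : setT (tprefix t, tnth t ord_max) by [];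
    rewrite FT => -[i _ Fi]; exists i.
move=> i; have [mF Fi] := Ffin i; split.
  rewrite -[X in measurable X]setTI.
  apply: (_ : measurable_fun setT (fun t : n.+1.-tuple Y => (tprefix t, tnth t ord_max))) => //.
  by apply/measurable_fun_pairP; split => /=; [exact: measurable_tprefix|exact: measurable_tnth].
rewrite /= /snoc_measure /pushforward /=.
rewrite (_ : _ @^-1` _ = F i)//.
by apply/seteqP; split => -[t a] /=; rewrite tprefix_snoc tnth_rcons_ord_max.
Qed.

Lemma integral_powmS n (F : n.+1.-tuple Y -> \bar R) :
  measurable_fun setT F -> (forall y, 0 <= F y) ->
  \int[powm mu n.+1]_y F y = \int[powm mu n]_y \int[mu]_a F (snoc (y, a)).
Proof.
move=> mF F0; rewrite /= /snoc_measure.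
rewrite ge0_integral_pushforward//=; last exact: measurable_snoc.
rewrite preimage_setT.
apply: (@sigma_finite_fubini_tonelli1 _ _ _ _ _ _ (sigma_finite_powm n) mu
  (F \o @snoc Y n)) => //=.
by apply: measurableT_comp => //; exact: measurable_snoc.
Qed.

Lemma measurable_integral_snoc n (F : n.+1.-tuple Y -> \bar R) :
  measurable_fun setT F -> (forall y, 0 <= F y) ->
  measurable_fun setT (fun y => \int[mu]_a F (snoc (y, a))).
Proof.
move=> mF F0.
apply: (measurable_fun_fubini_tonelli_F (F \o @snoc Y n)) => //=.
by apply: measurableT_comp => //; exact: measurable_snoc.
Qed.

Lemma integral_powm0 (F : 0.-tuple Y -> \bar R) :
  measurable_fun setT F -> \int[powm mu 0]_y F y = F [tuple].
Proof. by move=> mF; rewrite /= integral_dirac//= diracT mul1e. Qed.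

End power_measure.

(** * The terminal risk *)

Section risk.
Context {R : realType} {m : nat}.
Variable lambda : 'I_m.+1 -> 'I_m.+1 -> R.
Hypothesis lambda_ge0 : forall i j : 'I_m.+1, i != j -> 0 <= lambda i j.

Implicit Types (v w : 'I_m.+1 -> R) (z : m.-tuple R).

Let risk v j := \sum_(i < m.+1 | i != j) lambda i j * v i.

(** A crude Lipschitz constant for [g] in the distance [l1dist]; it dominates every off-diagonal
    [lambda i j]. *)
Definition total_loss : R := \sum_(j < m.+1) \sum_(i < m.+1 | i != j) lambda i j.

Definition l1dist z z' : R := \sum_(r < m) `|tnth z r - tnth z' r|.

Definition zero_tuple : m.-tuple R := [tuple 0 | r < m].

Lemma minrisk_le v j : minrisk lambda v <= risk v j.
Proof. by apply: bigmin_le_cond. Qed.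

Lemma minrisk_attained v : exists j, minrisk lambda v = risk v j.
Proof.
rewrite /minrisk -/(risk v).
elim/big_rec: _ => [|j _ _ [k ->]]; first by exists ord0.
by rewrite minEle; case: ifP => _; [exists j|exists k].
Qed.

Lemma minrisk_ge0 v : (forall i, 0 <= v i) -> 0 <= minrisk lambda v.
Proof.
move=> v0; have [j ->] := minrisk_attained v.
by apply: sumr_ge0 => i ij; rewrite mulr_ge0 ?lambda_ge0.
Qed.

Lemma minriskZ (a : R) v :
  0 <= a -> minrisk lambda (fun i => a * v i) = a * minrisk lambda v.
Proof.
move=> a0.
have riskZ j : risk (fun i => a * v i) j = a * risk v j.
  by rewrite /risk mulr_sumr; apply: eq_bigr => i _; rewrite mulrCA.
apply/eqP; rewrite eq_le; apply/andP; split.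
  have [j ->] := minrisk_attained v.
  by rewrite -riskZ; exact: minrisk_le.
have [j ->] := minrisk_attained (fun i => a * v i).
by rewrite riskZ ler_wpM2l // minrisk_le.
Qed.

Lemma total_loss_ge0 : 0 <= total_loss.
Proof. by apply: sumr_ge0 => j _; apply: sumr_ge0 => i ij; exact: lambda_ge0. Qed.

Lemma lambda_le_total i j : i != j -> lambda i j <= total_loss.
Proof.
move=> ij; rewrite /total_loss (bigD1 j)//= (bigD1 i)//= -addrA lerDl.
apply: addr_ge0; first by apply: sumr_ge0 => k /andP[kj _]; exact: lambda_ge0.
by apply: sumr_ge0 => k _; apply: sumr_ge0 => l lk; exact: lambda_ge0.
Qed.

Lemma minrisk_lipschitz v w :
  minrisk lambda v <= minrisk lambda w + total_loss * \sum_i `|v i - w i|.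
Proof.
(* A minimiser for [w] is used as a competitor for [v], so that only two sums with the same [j] are
   compared. *)
have [j ->] := minrisk_attained w; apply: le_trans (minrisk_le v j) _.
rewrite -lerBlDl /risk -sumrB mulr_sumr.
rewrite [leRHS](bigID (fun i => i != j)) /= -[leLHS]addr0 lerD//.
  apply: ler_sum => i ij; rewrite -mulrBr.
  apply: le_trans (_ : lambda i j * `|v i - w i| <= _).
    by rewrite ler_wpM2l ?lambda_ge0 ?ler_norm.
  by rewrite ler_wpM2r ?lambda_le_total.
by apply: sumr_ge0 => i _; rewrite mulr_ge0// total_loss_ge0.
Qed.

Lemma g_lipschitz z z' : g lambda z <= g lambda z' + total_loss * l1dist z z'.
Proof.
apply: le_trans (minrisk_lipschitz _ (tnth (cons_tuple 1 z'))) _.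
rewrite lerD2l ler_wpM2l ?total_loss_ge0//.
by rewrite big_ord_recl !tnth0 subrr normr0 add0r /l1dist; under eq_bigr do rewrite !tnthS.
Qed.

Lemma g_ge0 z : nonneg_tuple z -> 0 <= g lambda z.
Proof.
move=> z0; apply: minrisk_ge0 => i.
by have [j ->|->] := unliftP ord0 i; rewrite ?tnth0 ?tnthS.
Qed.

Lemma nonneg_zero_tuple : nonneg_tuple zero_tuple.
Proof. by move=> r; rewrite tnth_mktuple. Qed.

(** Deciding for the first hypothesis omits the constant coordinate z_1 = 1 from the sum, and all
    other coordinates vanish. With the Lipschitz bound this yields a linear bound on [g]. *)
Lemma g_zero_tuple : g lambda zero_tuple = 0.
Proof.
apply/eqP; rewrite eq_le g_ge0 ?andbT; last exact: nonneg_zero_tuple.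
apply: le_trans (minrisk_le _ ord0) _; rewrite /risk big1// => i i0.
have [j ->|i00] := unliftP ord0 i; last by rewrite i00 eqxx in i0.
by rewrite tnthS tnth_mktuple mulr0.
Qed.

Lemma l1dist_ge0 z z' : 0 <= l1dist z z'.
Proof. exact: sumr_ge0. Qed.

Lemma l1distC z z' : l1dist z z' = l1dist z' z.
Proof. by apply: eq_bigr => r _; rewrite distrC. Qed.

Lemma l1dist0 z : nonneg_tuple z -> l1dist z zero_tuple = \sum_(r < m) tnth z r.
Proof.
by move=> z0; apply: eq_bigr => r _; rewrite tnth_mktuple subr0 ger0_norm.
Qed.

End risk.

Local Notation history X Y n := (n.-tuple X * n.-tuple Y)%type.

(** * Histories and likelihood ratios *)

(** Inversion is continuous off 0, and on the single remaining point every function is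
    measurable. *)
Lemma measurable_inv (R : realType) : measurable_fun [set: R] (@GRing.inv R).
Proof.
rewrite -(setvU [set 0]) measurable_funU//; last exact: measurableC.
split; last exact: measurable_fun_set1.
apply: open_continuous_measurable_fun; first exact/closed_openC/closed_eq.
by move=> x; rewrite inE => /eqP x0; exact: inv_continuous.
Qed.

Section histories.
Context {R : realType} {dX dY : measure_display}.
Context {X : measurableType dX} {Y : measurableType dY}.
Variable s : strategy R X Y.

Lemma hist_snoc n (y : n.-tuple Y) (a : Y) :
  hist s (snoc (y, a)) = (rcons_tuple (controls s y) (chi s (hist s y)), snoc (y, a)).
Proof. by rewrite /hist /= tprefix_snoc. Qed.

Lemma hprefix_hist n (y : n.+1.-tuple Y) :
  hprefix (hist s y) = hist s (tprefix y).
Proof. by rewrite /hprefix /hist /= tprefix_rcons. Qed.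

Lemma measurable_hist n : measurable_fun setT (@hist _ _ _ _ _ s n).
Proof.
apply/measurable_fun_pairP; split; last exact: measurable_id.
rewrite (_ : _ \o _ = controls s (n := n)); last exact/funext.
elim: n => [|n IHn]; first exact: measurable_cst.
rewrite (_ : controls s (n := n.+1) = @snoc X n \o
   (fun y => (controls s y, chi s (controls s y, y))) \o @tprefix Y n); last exact/funext.
apply: measurableT_comp; last exact: measurable_tprefix.
apply: measurableT_comp; first exact: measurable_snoc.
apply/measurable_fun_pairP; split; first exact: IHn.
apply: (measurableT_comp (@measurable_chi _ _ _ _ _ s n)).
by apply/measurable_fun_pairP; split; [exact: IHn|exact: measurable_id].
Qed.

Lemma surv_ge0 n (h : history X Y n) : 0 <= surv s h.
Proof. by elim: n h => //= n IHn h; rewrite mulr_ge0 ?subr_ge0 ?psi_le1. Qed.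

Lemma stop_ge0 n (h : history X Y n.+1) : 0 <= stop s h.
Proof. by rewrite mulr_ge0 ?surv_ge0 ?psi_ge0. Qed.

Lemma stop_surv n (h : history X Y n.+1) : stop s h + surv s h = surv s (hprefix h).
Proof. by rewrite /stop /= mulrBr mulr1 addrC subrK. Qed.

Lemma measurable_hprefix n : measurable_fun setT (@hprefix _ _ X Y n).
Proof.
apply/measurable_fun_pairP; split.
  by apply: (measurableT_comp (measurable_tprefix (n := n))); exact: measurable_fst.
by apply: (measurableT_comp (measurable_tprefix (n := n))); exact: measurable_snd.
Qed.

Lemma measurable_surv n : measurable_fun setT (@surv _ _ _ _ _ s n).
Proof.
elim: n => [|n IHn]; first exact: measurable_cst.
apply: measurable_funM.
  by apply: (measurableT_comp IHn); exact: measurable_hprefix.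
by apply: measurable_funB; [exact: measurable_cst|exact: measurable_psi].
Qed.

Lemma measurable_surv_hist n : measurable_fun setT (fun y : n.-tuple Y => surv s (hist s y)).
Proof. exact: (measurableT_comp (measurable_surv (n := n)) (measurable_hist (n := n))). Qed.

Lemma measurable_psi_hist n : measurable_fun setT (fun y : n.+1.-tuple Y => psi s (hist s y)).
Proof. exact: (measurableT_comp (measurable_psi s (n := n)) (measurable_hist (n := n.+1))). Qed.

Lemma measurable_chi_hist n : measurable_fun setT (fun y : n.-tuple Y => chi s (hist s y)).
Proof. exact: (measurableT_comp (measurable_chi s (n := n)) (measurable_hist (n := n))). Qed.

Lemma measurable_stop_hist n : measurable_fun setT (fun y : n.+1.-tuple Y => stop s (hist s y)).
Proof.
apply: measurable_funM; last exact: measurable_psi_hist.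
apply: (measurableT_comp (measurable_surv (n := n))).
by apply: (measurableT_comp (@measurable_hprefix n)); exact: measurable_hist.
Qed.

End histories.

Section likelihood.
Context {R : realType} {dX dY : measure_display}.
Context {X : measurableType dX} {Y : measurableType dY} {m : nat}.
Variable f : 'I_m.+1 -> X -> Y -> R.
Hypothesis f_ge0 : forall i x y, 0 <= f i x y.
Hypothesis measurable_f :
  forall i, measurable_fun setT (fun xy : X * Y => f i xy.1 xy.2).
Hypothesis f_supp : forall x : X,
    [set y | f ord0 x y = 0]
      `<=` \bigcap_(i in [set i : 'I_m.+1 | i != ord0]) [set y | f i x y = 0].

(** The support condition enters here: where f_1 vanishes so does f_r, and the convention that the
    quotient is 0 does no harm. *)
Lemma ratioK r x y : f (lift ord0 r) x y / f ord0 x y * f ord0 x y = f (lift ord0 r) x y.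
Proof.
have [f0|f0] := eqVneq (f ord0 x y) 0; last by rewrite divfK.
by rewrite f0 mulr0; apply/esym/(f_supp f0).
Qed.

Lemma jdens_ge0 i n (h : history X Y n) : 0 <= jdens f i h.
Proof. exact: prodr_ge0. Qed.

Lemma nonneg_LR n (h : history X Y n) : nonneg_tuple (LR f h).
Proof. by move=> r; rewrite tnth_mktuple prodr_ge0// => i _; rewrite divr_ge0. Qed.

Lemma nonneg_update x y z : nonneg_tuple z -> nonneg_tuple (update f x y z).
Proof. by move=> z0 r; rewrite tnth_mktuple mulr_ge0 ?divr_ge0. Qed.

(** Change of measure: weighting by Z^r under theta_1 gives expectations under theta_r. *)
Lemma LR_jdens r n (h : history X Y n) :
  tnth (LR f h) r * jdens f ord0 h = jdens f (lift ord0 r) h.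
Proof.
rewrite tnth_mktuple /jdens -big_split /=.
by apply: eq_bigr => i _; rewrite ratioK.
Qed.

Lemma lrisk_LR (lambda : 'I_m.+1 -> 'I_m.+1 -> R) n (h : history X Y n) :
  lrisk f lambda h = g lambda (LR f h) * jdens f ord0 h.
Proof.
rewrite mulrC -minriskZ ?jdens_ge0//; congr minrisk; apply/funext => i.
have [r ->|->] := unliftP ord0 i; last by rewrite tnth0 mulr1.
by rewrite tnthS mulrC LR_jdens.
Qed.

Lemma jdens_snoc (s : strategy R X Y) i n (y : n.-tuple Y) a :
  jdens f i (hist s (snoc (y, a))) = jdens f i (hist s y) * f i (chi s (hist s y)) a.
Proof.
rewrite hist_snoc /jdens big_ord_recr /= !tnth_rcons_ord_max; congr (_ * _).
by apply: eq_bigr => j _; rewrite !tnth_rcons_widen.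
Qed.

Lemma LR_snoc (s : strategy R X Y) n (y : n.-tuple Y) a :
  LR f (hist s (snoc (y, a))) = update f (chi s (hist s y)) a (LR f (hist s y)).
Proof.
apply: eq_from_tnth => r; rewrite hist_snoc !tnth_mktuple.
rewrite big_ord_recr /= !tnth_rcons_ord_max; congr (_ * _).
by apply: eq_bigr => j _; rewrite !tnth_rcons_widen.
Qed.

Lemma jdens_nil i (h : history X Y 0) : jdens f i h = 1.
Proof. by rewrite /jdens big_ord0. Qed.

Lemma LR_nil (h : history X Y 0) : LR f h = [tuple 1 | r < m].
Proof. by apply: eq_from_tnth => r; rewrite !tnth_mktuple big_ord0. Qed.

Let measurable_f_tnth n i (j : 'I_n) :
  measurable_fun setT (fun h : history X Y n => f i (tnth h.1 j) (tnth h.2 j)).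
Proof.
apply: (measurableT_comp (measurable_f i)
  (g := fun h : history X Y n => (tnth h.1 j, tnth h.2 j))).
apply/measurable_fun_pairP; split.
  by apply: (measurableT_comp (@measurable_tnth _ _ n j)); exact: measurable_fst.
by apply: (measurableT_comp (@measurable_tnth _ _ n j)); exact: measurable_snd.
Qed.

Lemma measurable_ratio (d : measure_display) (T : measurableType d) (u v : T -> R) :
  measurable_fun setT u -> measurable_fun setT v ->
  measurable_fun setT (fun t => u t / v t).
Proof.
move=> mu mv; apply: measurable_funM => //.
exact: (measurableT_comp (@measurable_inv R)).
Qed.

Lemma measurable_jdens i n : measurable_fun setT (@jdens _ _ _ X Y m f i n).
Proof. by apply: measurable_prod => j _; exact: measurable_f_tnth. Qed.

Lemma measurable_LR n : measurable_fun setT (@LR _ _ _ X Y m f n).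
Proof.
apply/measurable_fun_tnthP => r.
rewrite (_ : _ \o _ = fun h : history X Y n => \prod_(i < n)
   (f (lift ord0 r) (tnth h.1 i) (tnth h.2 i) / f ord0 (tnth h.1 i) (tnth h.2 i))).
  by apply: measurable_prod => j _; apply: measurable_ratio; exact: measurable_f_tnth.
by apply/funext => h /=; rewrite tnth_mktuple.
Qed.

Lemma measurable_jdens_hist (s : strategy R X Y) i n :
  measurable_fun setT (fun y : n.-tuple Y => jdens f i (hist s y)).
Proof. exact: (measurableT_comp (measurable_jdens i (n := n)) (measurable_hist s (n := n))). Qed.

Lemma measurable_LR_hist (s : strategy R X Y) n :
  measurable_fun setT (fun y : n.-tuple Y => LR f (hist s y)).
Proof. exact: (measurableT_comp (@measurable_LR n) (measurable_hist s (n := n))). Qed.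

Lemma measurable_update x z : measurable_fun setT (fun y => update f x y z).
Proof.
apply/measurable_fun_tnthP => r.
rewrite (_ : _ \o _ = fun y => tnth z r * (f (lift ord0 r) x y / f ord0 x y)).
  apply: measurable_funM; first exact: measurable_cst.
  by apply: measurable_ratio; exact: measurableT_comp (measurable_f _) (measurable_pair1 x).
by apply/funext => h /=; rewrite tnth_mktuple.
Qed.

Lemma measurable_density i x : measurable_fun setT (f i x).
Proof. exact: measurableT_comp (measurable_f _) (measurable_pair1 x). Qed.

Lemma measurable_nonneg_comp d (T : measurableType d) (h : m.-tuple R -> \bar R)
    (u : T -> m.-tuple R) :
  measurable_fun (@nonneg_tuple R m) h -> measurable_fun setT u ->
  (forall t, nonneg_tuple (u t)) -> measurable_fun setT (h \o u).
Proof.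
move=> mh mu u0; apply: (measurable_comp _ _ mh mu); first exact: measurable_nonneg_tuple.
by move=> _ [t _ <-].
Qed.

End likelihood.

(** * Tail sums of series *)

Section tail_sums.
Local Open Scope ereal_scope.
Context {R : realType}.
Variables e v : nat -> \bar R.
Hypothesis e_ge0 : forall n, 0 <= e n.
Hypothesis v_rec : forall n, v n = e n + v n.+1.
Hypothesis cvg_v : v n @[n --> \oo] --> 0.

(** By telescoping, the partial sum up to [n] plus [v n] is constantly [v k]; then [v n] tends to
    0. *)
Lemma tail_sum k : v k = \sum_(k <= j <oo) e j.
Proof.
have vE n : (k <= n)%N -> v k = \sum_(k <= j < n) e j + v n.
  move=> /subnK <-; elim: (n - k)%N => [|i IHi]; first by rewrite add0n big_geq ?add0e.
  by rewrite addSn big_nat_recr ?leq_addl//= -addeA -v_rec.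
have cvg_e : (\sum_(k <= j < n) e j + v n) @[n --> \oo] --> \sum_(k <= j <oo) e j + 0.
  apply: cvgeD; [by rewrite fin_num_adde_defl| |exact: cvg_v].
  by apply: is_cvg_nneseries => j _ _; exact: e_ge0.
rewrite adde0 in cvg_e; rewrite -(cvg_lim _ cvg_e)//; apply/esym; apply: lim_near_cst => //.
by exists k => // n /= kn; rewrite -vE.
Qed.

(** The identity E tau = sum_k P(tau > k), obtained by summing in both orders the array equal to
    [e j] for k <= j and to 0 elsewhere. *)
Lemma sum_tail_sum : \sum_(0 <= j <oo) j.+1%:R%:E * e j = \sum_(0 <= k <oo) v k.
Proof.
pose a k j := if (k <= j)%N then e j else 0.
have a0 k j : 0 <= a k j by rewrite /a; case: ifP.
transitivity (\sum_(k <oo) \sum_(j <oo) a k j); last first.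
  by apply: eq_eseriesr => k _; rewrite tail_sum [RHS]eseries_cond [RHS]eseries_mkcond.
rewrite nneseries_interchange//; apply: eq_eseriesr => j _.
rewrite (@nneseries_split _ _ 0%N j.+1)// eseries0 ?adde0; last first.
  by move=> k jk _; rewrite /a leqNgt jk.
rewrite add0n big_nat (eq_bigr (fun=> e j)); last first.
  by move=> k /andP[_ kj]; rewrite /a -ltnS kj.
by rewrite -big_nat big_const_nat subn0 iter_addr_0 mule_natl.
Qed.

End tail_sums.

(** * The functions rho_r, rho and R *)

Section dynamic_programming.
Local Open Scope ereal_scope.
Context {R : realType} {dX dY : measure_display}.
Context {X : measurableType dX} {Y : measurableType dY}.
Variable mu : {sigma_finite_measure set Y -> \bar R}.
Context {m : nat}.
Variable f : 'I_m.+1 -> X -> Y -> R.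
Variable lambda : 'I_m.+1 -> 'I_m.+1 -> R.
Hypothesis f_ge0 : forall i x y, (0 <= f i x y)%R.
Hypothesis measurable_f :
  forall i, measurable_fun setT (fun xy : X * Y => f i xy.1 xy.2).
Hypothesis integral_f : forall i x, \int[mu]_y (f i x y)%:E = 1.
Hypothesis lambda_ge0 : forall i j : 'I_m.+1, i != j -> (0 <= lambda i j)%R.
Hypothesis f_supp : forall x : X,
    [set y | f ord0 x y = 0%R]
      `<=` \bigcap_(i in [set i : 'I_m.+1 | i != ord0]) [set y | f i x y = 0%R].

Implicit Types (h : m.-tuple R -> \bar R) (z : m.-tuple R) (x : X).

(** Written one-sidedly to avoid subtraction of extended reals; exchanging [z] and [z'] gives the
    other side. *)
Definition lipschitz_nonneg (C : R) h :=
  forall z z', nonneg_tuple z -> nonneg_tuple z' ->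
    h z <= h z' + (C * l1dist z z')%:E.

Local Notation C := (total_loss lambda).
Local Notation nonneg := (@nonneg_tuple R m).

Lemma min_ctrl_le (c : X -> \bar R) x : min_ctrl c <= c x.
Proof. by rewrite /min_ctrl; apply: ereal_inf_lbound; exists x. Qed.

(** * The one-step expectation and its Lipschitz bound *)

Section one_step.
Variable h : m.-tuple R -> \bar R.
Hypothesis measurable_h : measurable_fun nonneg h.
Hypothesis h_ge0 : forall z, nonneg z -> 0 <= h z.

Lemma measurable_step_integrand z x : nonneg z ->
  measurable_fun setT (fun y => (f ord0 x y)%:E * h (update f x y z)).
Proof.
move=> z0; apply: emeasurable_funM.
  by apply/measurable_EFinP; exact: measurable_density.
apply: (measurable_nonneg_comp measurable_h (measurable_update measurable_f x z)).
by move=> y; exact: nonneg_update.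
Qed.

Lemma step_integrand_ge0 z x y : nonneg z -> 0 <= (f ord0 x y)%:E * h (update f x y z).
Proof. by move=> z0; rewrite mule_ge0 ?lee_fin// h_ge0//; exact: nonneg_update. Qed.

Lemma step_ge0 z x : nonneg z -> 0 <= step mu f h z x.
Proof. by move=> z0; apply: integral_ge0 => y _; exact: step_integrand_ge0. Qed.

Lemma min_ctrl_step_ge0 z : nonneg z -> 0 <= min_ctrl (step mu f h z).
Proof. by move=> z0; apply: le_ereal_inf_tmp => _ [x _ <-]; exact: step_ge0. Qed.

(** After weighting by f_1, the updated r-th coordinates differ by |z_r - z'_r| f_r, and each f_r
    integrates to 1. Hence the constant is preserved and does not depend on [x]. *)
Lemma step_lipschitz x : lipschitz_nonneg C h -> lipschitz_nonneg C (step mu f h ^~ x).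
Proof.
move=> hC z z' z0 z'0.
pose c r : R := (C * `|tnth z r - tnth z' r|)%R.
have c0 r : (0 <= c r)%R by rewrite mulr_ge0// total_loss_ge0.
have -> : (C * l1dist z z')%:E = \int[mu]_y \sum_(r < m) (c r * f (lift ord0 r) x y)%:E.
  rewrite ge0_integral_sum//; last 2 first.
  - move=> r; apply/measurable_EFinP; apply: measurable_funM => //.
    exact: measurable_density.
  - by move=> r y _; rewrite lee_fin mulr_ge0.
  rewrite /l1dist mulr_sumr -sumEFin; apply: eq_bigr => r _.
  under eq_integral do rewrite EFinM.
  rewrite ge0_integralZl ?integral_f ?mule1 ?lee_fin//.
  - by apply/measurable_EFinP; exact: measurable_density.
  - by move=> y _; rewrite lee_fin.
rewrite /step -ge0_integralD//; last 4 first.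
- by move=> y _; exact: step_integrand_ge0.
- exact: measurable_step_integrand.
- by move=> y _; apply: sume_ge0 => r _; rewrite lee_fin mulr_ge0.
- apply: emeasurable_sum => r; apply/measurable_EFinP; apply: measurable_funM => //.
  exact: measurable_density.
apply: ge0_le_integral => //.
- by move=> y _; exact: step_integrand_ge0.
- exact: measurable_step_integrand.
- apply: emeasurable_funD; first exact: measurable_step_integrand.
  apply: emeasurable_sum => r; apply/measurable_EFinP; apply: measurable_funM => //.
  exact: measurable_density.
move=> y _.
have u0 := nonneg_update f_ge0 x y z0; have u'0 := nonneg_update f_ge0 x y z'0.
have -> : \sum_(r < m) (c r * f (lift ord0 r) x y)%:E =
   (f ord0 x y)%:E * (C * l1dist (update f x y z) (update f x y z'))%:E.
  rewrite sumEFin -EFinM /l1dist !mulr_sumr; congr EFin; apply: eq_bigr => r _.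
  rewrite !tnth_mktuple -mulrBl normrM (@ger0_norm _ (_ / _)) ?divr_ge0//.
  by rewrite -[in LHS](ratioK f_supp) /c; ring.
rewrite -ge0_muleDr ?h_ge0//; first by rewrite lee_wpmul2l ?lee_fin// hC.
by rewrite lee_fin mulr_ge0// ?total_loss_ge0// l1dist_ge0.
Qed.

End one_step.

Lemma le_step h h' z x : measurable_fun nonneg h -> measurable_fun nonneg h' ->
  (forall z, nonneg z -> 0 <= h z <= h' z) -> nonneg z ->
  step mu f h z x <= step mu f h' z x.
Proof.
move=> mh mh' hh' z0.
have h0 z1 : nonneg z1 -> 0 <= h z1 by move=> /hh'/andP[].
apply: ge0_le_integral => //.
- by move=> y _; exact: step_integrand_ge0.
- exact: measurable_step_integrand.
- exact: measurable_step_integrand.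
move=> y _; rewrite lee_wpmul2l ?lee_fin//.
by have /hh'/andP[] := nonneg_update f_ge0 x y z0.
Qed.

Lemma min_ctrl_lipschitz K (c : m.-tuple R -> X -> \bar R) :
  (forall x, lipschitz_nonneg K (c ^~ x)) ->
  lipschitz_nonneg K (fun z => min_ctrl (c z)).
Proof.
move=> cK z z' z0 z'0; rewrite -leeBlDr//.
apply: le_ereal_inf_tmp => _ [x _ <-]; rewrite leeBlDr//.
exact: le_trans (min_ctrl_le _ x) (cK x z z' z0 z'0).
Qed.

Lemma lipschitz_mine K h h' : lipschitz_nonneg K h -> lipschitz_nonneg K h' ->
  lipschitz_nonneg K (fun z => mine (h z) (h' z)).
Proof.
move=> hK h'K z z' z0 z'0; rewrite ge_min.
by rewrite minEle; case: ifP => _; rewrite ?hK ?h'K ?orbT.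
Qed.

(** * The limit of the recursion and its fixed-point equation *)

Hypothesis minima : minima_well_defined mu f lambda.

Local Notation rho_ := (rho_ mu f lambda).
Local Notation rho := (rho mu f lambda).
Local Notation Rfun := (Rfun mu f lambda).
Local Notation g := (g lambda).
Local Notation step := (step mu f).

Lemma measurable_rho_ r : measurable_fun nonneg (rho_ r).
Proof. by case: minima => _ _ + _; exact. Qed.

Lemma measurable_g : measurable_fun nonneg (fun z => (g z)%:E).
Proof. exact: (measurable_rho_ 0). Qed.

Lemma rho_le_g r z : rho_ r z <= (g z)%:E.
Proof. by case: r => [|r] //=; rewrite ge_min lexx. Qed.

Lemma rho_ge0 r z : nonneg z -> 0 <= rho_ r z.
Proof.
elim: r z => [|r IHr] z z0 /=; first by rewrite lee_fin g_ge0.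
by rewrite le_min lee_fin g_ge0// adde_ge0// min_ctrl_step_ge0.
Qed.

Lemma le_min_ctrl (c c' : X -> \bar R) : (forall x, c x <= c' x) -> min_ctrl c <= min_ctrl c'.
Proof.
move=> cc'; apply: le_ereal_inf_tmp => _ [x _ <-].
exact: le_trans (min_ctrl_le _ x) (cc' x).
Qed.

Lemma rho_S_le r z : nonneg z -> rho_ r.+1 z <= rho_ r z.
Proof.
elim: r z => [|r IHr] z z0; first by rewrite /= ge_min lexx.
rewrite /= le_min !ge_min lexx /= leeD2l ?orbT//.
apply: le_min_ctrl => x; apply: (@le_step (rho_ r.+1) (rho_ r)) => //.
- exact: measurable_rho_.
- exact: measurable_rho_.
by move=> z' z'0; rewrite rho_ge0// IHr.
Qed.

Lemma rho_nonincreasing z : nonneg z -> nonincreasing_seq (rho_ ^~ z).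
Proof. by move=> z0; apply/nonincreasing_seqP => r; exact: rho_S_le. Qed.

Lemma cvg_rho z : nonneg z -> rho_ ^~ z @ \oo --> rho z.
Proof. by move=> /rho_nonincreasing; exact: ereal_nonincreasing_is_cvgn. Qed.

Lemma rho_lim_le r z : nonneg z -> rho z <= rho_ r z.
Proof.
move=> z0; apply: (cvge_to_le (cvg_rho z0)); exists r => // k /= rk.
exact: rho_nonincreasing.
Qed.

Lemma rho_lim_le_g z : nonneg z -> rho z <= (g z)%:E.
Proof. exact: (@rho_lim_le 0). Qed.

Lemma rho_lim_ge0 z : nonneg z -> 0 <= rho z.
Proof.
move=> z0; apply: (cvge_to_ge (cvg_rho z0)); apply: nearW => k.
exact: rho_ge0.
Qed.

Lemma measurable_rho : measurable_fun nonneg rho.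
Proof. by apply: (emeasurable_fun_cvg _ _ measurable_rho_) => z; exact: cvg_rho. Qed.

Lemma rho_lipschitz r : lipschitz_nonneg C (rho_ r).
Proof.
elim: r => [|r IHr].
  by move=> z z' z0 z'0; rewrite /= -EFinD lee_fin g_lipschitz.
apply: lipschitz_mine.
  by move=> z z' z0 z'0; rewrite -EFinD lee_fin g_lipschitz.
move=> z z' z0 z'0; rewrite -addeA leeD2l//.
apply: (@min_ctrl_lipschitz _ (fun z x => step (rho_ r) z x)) => // x.
by apply: step_lipschitz => //; [exact: measurable_rho_|exact: rho_ge0].
Qed.

(** It suffices to treat [g]. Its one-step expectation is Lipschitz and vanishes at [zero_tuple],
    which every update fixes. *)
Lemma step_le_l1dist h z x : measurable_fun nonneg h ->
  (forall z, nonneg z -> 0 <= h z <= (g z)%:E) -> nonneg z ->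
  step h z x <= (C * l1dist z zero_tuple)%:E.
Proof.
move=> mh hg z0; apply: (@le_trans _ _ (step (rho_ 0) z x)).
  by apply: le_step => //; exact: measurable_g.
have := @step_lipschitz (rho_ 0) (measurable_rho_ 0) (@rho_ge0 0) x (@rho_lipschitz 0)
  z zero_tuple z0 nonneg_zero_tuple.
move=> /le_trans; apply; rewrite -[leRHS]add0e leeD2r//.
rewrite /Defs.step integral0_eq// => y _.
rewrite (_ : update f x y zero_tuple = zero_tuple); last first.
  by apply: eq_from_tnth => r; rewrite !tnth_mktuple mul0r.
by rewrite /= g_zero_tuple// mule0.
Qed.

Lemma step_fin_num h z x : measurable_fun nonneg h ->
  (forall z, nonneg z -> 0 <= h z <= (g z)%:E) -> nonneg z ->
  step h z x \is a fin_num.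
Proof.
move=> mh hg z0; rewrite ge0_fin_numE.
  by apply: le_lt_trans (step_le_l1dist x mh hg z0) _; exact: ltry.
by apply: step_ge0 => // z1 /hg/andP[].
Qed.

Lemma cvg_step_rho z x : nonneg z -> step (rho_ r) z x @[r --> \oo] --> step rho z x.
Proof.
move=> z0.
(* All [rho_ r] lie below [g], whose one-step expectation is finite by the linear bound. *)
apply: (@dominated_cvg _ _ _ _ _ _ _ _ (fun y => (f ord0 x y)%:E * (g (update f x y z))%:E)) => //.
- by move=> r; apply: measurable_step_integrand => //; exact: measurable_rho_.
- move=> y _; apply: cvgeZl => //.
  by apply: cvg_rho; exact: nonneg_update.
- apply/integrableP; split.
    by apply: (measurable_step_integrand measurable_g).
  rewrite (_ : \int[mu]_y _ = step (fun z => (g z)%:E) z x).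
    apply: le_lt_trans (step_le_l1dist x measurable_g _ z0) (ltry _).
    by move=> z1 z10; rewrite lee_fin g_ge0//= lexx.
  apply: eq_integral => y _.
  by rewrite gee0_abs// -EFinM lee_fin mulr_ge0 ?g_ge0//; exact: nonneg_update.
move=> r y _; rewrite gee0_abs; last first.
  by apply: step_integrand_ge0 => //; exact: rho_ge0.
by rewrite lee_wpmul2l ?lee_fin ?rho_le_g.
Qed.

Lemma Rfun_le_min_ctrl r z : nonneg z -> Rfun z <= min_ctrl (step (rho_ r) z).
Proof.
move=> z0; apply: le_min_ctrl => x; apply: le_step => //.
- exact: measurable_rho.
- exact: measurable_rho_.
- by move=> z1 z10; rewrite rho_lim_ge0// rho_lim_le.
Qed.

(** Minimum and limit commute: a control [x0] that is optimal for [rho] serves as a competitor for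
    every [rho_ r], and the minima are squeezed between [Rfun z] and the values at [x0]. *)
Lemma cvg_min_ctrl_step_rho z : nonneg z ->
  min_ctrl (step (rho_ r) z) @[r --> \oo] --> Rfun z.
Proof.
move=> z0; have [_ /(_ z z0)[x0 x0min] _ _] := minima.
apply: (@squeeze_cvge _ _ _ _ (fun=> Rfun z) _ (fun r => step (rho_ r) z x0)).
- apply: nearW => r; rewrite Rfun_le_min_ctrl//=.
  exact: min_ctrl_le.
- exact: cvg_cst.
rewrite (_ : Rfun z = step rho z x0); first exact: cvg_step_rho.
apply/eqP; rewrite eq_le; apply/andP; split.
  exact: min_ctrl_le.
by apply: le_ereal_inf_tmp => _ [x _ <-].
Qed.

(** The Bellman equation, obtained by passing to the limit in the recursion for [rho_]. *)
Lemma rho_eq z : nonneg z -> rho z = mine (g z)%:E (1 + Rfun z).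
Proof.
move=> z0; apply/eqP; rewrite eq_le; apply/andP; split.
  rewrite le_min rho_lim_le_g//=.
  have cvgR : 1 + min_ctrl (step (rho_ r) z) @[r --> \oo] --> 1 + Rfun z.
    apply: cvgeD; [by rewrite fin_num_adde_defr|exact: cvg_cst|].
    exact: cvg_min_ctrl_step_rho.
  apply: (cvge_to_ge cvgR).
  apply: nearW => r; apply: le_trans (rho_lim_le r.+1 z0) _.
  by rewrite /= ge_min lexx orbT.
have := cvg_rho z0; rewrite -cvg_shiftS => cvgS; apply: (cvge_to_ge cvgS).
apply: nearW => r /=; rewrite le_min !ge_min lexx /= leeD2l ?orbT//.
exact: Rfun_le_min_ctrl.
Qed.

Lemma rho_fin_num z : nonneg z -> rho z \is a fin_num.
Proof.
move=> z0; rewrite ge0_fin_numE ?rho_lim_ge0//.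
exact: le_lt_trans (rho_lim_le_g z0) (ltry _).
Qed.

Let rho_bounds z : nonneg z -> 0 <= rho z <= (g z)%:E.
Proof. by move=> z0; rewrite rho_lim_ge0// rho_lim_le_g. Qed.

Lemma step_rho_fin_num z x : nonneg z -> step rho z x \is a fin_num.
Proof. by move=> z0; apply: step_fin_num => //; exact: measurable_rho. Qed.

Lemma Rfun_fin_num z : nonneg z -> Rfun z \is a fin_num.
Proof.
move=> z0; have [_ /(_ z z0)[x0 _] _ _] := minima.
rewrite ge0_fin_numE.
  by apply: le_lt_trans (min_ctrl_le _ x0) _; rewrite ltey_eq step_rho_fin_num.
by apply: min_ctrl_step_ge0 => //; exact: rho_lim_ge0.
Qed.

(* [p] is the probability of stopping and [x] the control used otherwise. *)
Lemma rho_le_randomized z x (p : R) : nonneg z -> (0 <= p <= 1)%R ->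
  rho z <= p%:E * (g z)%:E + (1 - p)%:E * (1 + step rho z x).
Proof.
move=> z0 /andP[p0 p1]; rewrite rho_eq//.
have := min_ctrl_le (step rho z) x; rewrite -/(Rfun z).
rewrite -(fineK (Rfun_fin_num z0)) -(fineK (step_rho_fin_num x z0)) lee_fin => Rle.
rewrite -!(EFinD 1) -EFin_min -!EFinM -EFinD lee_fin.
by rewrite minEle; case: ifP => [Gle|/negbT]; rewrite -?ltNge => *; nra.
Qed.

(** A convex combination of two numbers that are at least [rho z] equals [rho z] only if every
    number with positive weight does. When [g z] and [1 + Rfun z] agree, [p] stays free. *)
Lemma rho_eq_randomized z x (p : R) : nonneg z -> (0 <= p <= 1)%R ->
  rho z = p%:E * (g z)%:E + (1 - p)%:E * (1 + step rho z x) <->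
  [/\ (g z)%:E < 1 + Rfun z -> p = 1%R, 1 + Rfun z < (g z)%:E -> p = 0%R
    & (p < 1)%R -> step rho z x = Rfun z].
Proof.
move=> z0 /andP[p0 p1]; rewrite rho_eq//.
have := min_ctrl_le (step rho z) x; rewrite -/(Rfun z).
rewrite -(fineK (Rfun_fin_num z0)) -(fineK (step_rho_fin_num x z0)).
(* All three quantities are finite, which leaves a claim on reals: [a] is the value of the chosen
   control, [b] the minimum, [c] the terminal risk. *)
move: (fine (step rho z x)) (fine (Rfun z)) (g z) => a b c.
rewrite -!(EFinD 1) -EFin_min -!EFinM -EFinD !lte_fin lee_fin => ba.
split=> [[]|[p_eq1 p_eq0 ab]].
  rewrite minEle; case: ifP => [cb ceq|/negbT]; last rewrite -ltNge => bc ceq.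
    split.
    + move=> cb'; have : ((1 - p) * (1 + a - c) = 0)%R by rewrite [in RHS]/=; lra.
      move/eqP; rewrite mulf_eq0 => /orP[/eqP|/eqP]; lra.
    + lra.
    + move=> plt1; congr EFin; have : ((1 - p) * (1 + a - c) = 0)%R by lra.
      by move/eqP; rewrite mulf_eq0 => /orP[/eqP|/eqP]; lra.
  have p00 : p = 0%R.
    apply/eqP; rewrite eq_le p0 andbT leNgt; apply/negP => pgt0.
    by nra.
  by split; [lra|by []|move=> _; congr EFin; nra].
congr EFin; have [cb|bc|cb] := ltgtP c (1 + b)%R.
- by rewrite (p_eq1 cb); lra.
- have [ab1] : a%:E = b%:E by apply: ab; rewrite (p_eq0 bc) ltr01.
  by rewrite (p_eq0 bc) ab1; lra.
- have [/ab[ab1]|p1'] := ltrP p 1; first by rewrite cb ab1; lra.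
  by have -> : p = 1%R; lra.
Qed.

Lemma stop_between (a b : \bar R) (p : R) : (0 <= p <= 1)%R ->
  ((a < b)%E%:R <= p <= (a <= b)%E%:R)%R <-> (a < b -> p = 1%R) /\ (b < a -> p = 0%R).
Proof.
move=> /andP[p0 p1]; case: ltgtP => ab /=; split.
- by move=> /andP[p1' _]; split => // _; apply/eqP; rewrite eq_le p1 p1'.
- by case=> -> // _; rewrite lexx.
- by move=> /andP[_ p0']; split => // _; apply/eqP; rewrite eq_le p0 p0'.
- by case=> _ ->//; rewrite lexx.
- by move=> _.
- by move=> _; rewrite p0 p1.
Qed.

(** * Near-optimal controls *)

(** A preimage is a union of countably many level sets of [q]. This makes a selector that is
    constant on grid cells measurable. *)
Lemma countable_range_measurable d (T : measurableType d) d' (T' : measurableType d')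
    (Q : countType) (q : T -> Q) (b : Q -> T') :
  (forall k, measurable (q @^-1` [set k])) -> measurable_fun setT (b \o q).
Proof.
move=> mq _ B mB; rewrite setTI.
have -> : (b \o q) @^-1` B = \bigcup_(k in setT) (q @^-1` [set k] `&` [set t | B (b k)]).
  by apply/seteqP; split => [t Bt|t [k _ [/= <-]]//]; exists (q t).
apply: countable_bigcupT_measurable => // k.
have [Bk|nBk] := pselect (B (b k)).
  by rewrite (_ : [set _ | _] = setT) ?setIT//; apply/seteqP; split.
by rewrite (_ : [set _ | _] = set0) ?setI0//; apply/seteqP; split.
Qed.

Section grid.
Variable N : nat.

(** A grid of mesh 1/(N+1). Rounding down keeps the node of a nonnegative tuple nonnegative. *)
Definition cell (z : m.-tuple R) : m.-tuple int :=
  [tuple Num.floor (tnth z r * N.+1%:R) | r < m].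

Definition node (q : m.-tuple int) : m.-tuple R :=
  [tuple ((tnth q r)%:~R / N.+1%:R)%R | r < m].

Lemma measurable_cell q : measurable (cell @^-1` [set q]).
Proof.
rewrite (_ : _ @^-1` _ = \bigcap_(r in [set: 'I_m])
    ((fun z => tnth z r) @^-1` [set t | (tnth q r)%:~R <= t * N.+1%:R < (tnth q r + 1)%:~R]%R)).
  apply: fin_bigcap_measurable => // r _; rewrite -[X in measurable X]setTI.
  apply: measurable_tnth => //.
  rewrite (_ : [set t | _] = `[(tnth q r)%:~R / N.+1%:R, (tnth q r + 1)%:~R / N.+1%:R[%classic)%R.
    exact: measurable_itv.
  apply/seteqP; split => t; rewrite /= in_itv /= ?ler_pdivrMr ?ltr_pdivlMr//.
apply/seteqP; split => [z <- r _ /=|z zq].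
  by rewrite tnth_mktuple floor_le_tmp// floorD1_gt.
apply: eq_from_tnth => r; rewrite tnth_mktuple; apply: floor_def.
exact: (zq r I).
Qed.

Lemma nonneg_node z : nonneg z -> nonneg (node (cell z)).
Proof.
move=> z0 r; rewrite !tnth_mktuple divr_ge0// ler0z floor_ge0.
by rewrite mulr_ge0.
Qed.

Lemma l1dist_node z : (l1dist z (node (cell z)) <= m%:R / N.+1%:R)%R.
Proof.
rewrite /l1dist -[m in leRHS]card_ord -sum1_card natr_sum mulr_suml.
apply: ler_sum => r _; rewrite !tnth_mktuple mul1r.
rewrite -[X in (`|X - _|)%R](@mulfK _ N.+1%:R)// -mulrBl normrM.
rewrite [X in (_ * X <= _)%R]ger0_norm ?invr_ge0// ler_piMl ?invr_ge0//.
rewrite ger0_norm ?subr_ge0 ?floor_le_tmp//.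
by rewrite lerBlDr addrC -intrD1 ltW// floorD1_gt.
Qed.

End grid.

(* Attained minima need not have a measurable selector. Instead the control is
   chosen on a countable grid, the Lipschitz bound being uniform in [x]. *)
Lemma near_optimal_selector (K : R) (c : m.-tuple R -> X -> \bar R) (eps : R) :
  (0 <= K)%R -> (0 < eps)%R -> (forall x, lipschitz_nonneg K (c ^~ x)) ->
  (forall z, nonneg z -> attains_min (c z)) ->
  exists2 sel : m.-tuple R -> X, measurable_fun setT sel &
    forall z, nonneg z -> c z (sel z) <= min_ctrl (c z) + eps%:E.
Proof.
move=> K0 eps0 cK cmin.
(* The Lipschitz bound is used twice, from [z] to its node and back, and a node is at distance at
   most m/(N+1). *)
pose N := Num.bound ((K + K) * m%:R / eps)%R.
have Neps : ((K + K) * (m%:R / N.+1%:R) <= eps)%R.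
  rewrite mulrA ler_pdivrMr// -ler_pdivrMl// mulrC ltW//.
  apply: lt_trans (archi_boundP _) _; first by rewrite divr_ge0 ?mulr_ge0 ?addr_ge0// ltW.
  by rewrite ltr_nat.
have [x0 _] := cmin _ nonneg_zero_tuple.
(* An exact minimiser is chosen at each nonnegative node; [x0] is the default at the others. *)
have /choice[b bP] (q : m.-tuple int) : exists b, nonneg (node N q) ->
    forall x, c (node N q) b <= c (node N q) x.
  have [q0|nq] := pselect (nonneg (node N q)); last by exists x0 => /nq.
  by have [x xP] := cmin _ q0; exists x.
exists (b \o cell N).
  by apply: countable_range_measurable => q; exact: measurable_cell.
move=> z z0; set q := node N (cell N z).
have q0 : nonneg q := nonneg_node N z0.
rewrite -leeBlDr//; apply: le_ereal_inf_tmp => _ [x _ <-]; rewrite leeBlDr//.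
apply: le_trans (cK _ z q z0 q0) _.
apply: le_trans (_ : c q x + (K * l1dist z q)%:E <= _); first by rewrite leeD2r// bP.
apply: le_trans (_ : c z x + (K * l1dist z q)%:E + (K * l1dist z q)%:E <= _).
  by rewrite leeD2r// (l1distC z) cK.
rewrite -addeA leeD2l// -EFinD lee_fin -mulrDl.
by apply: le_trans Neps; rewrite ler_wpM2l ?addr_ge0 ?l1dist_node.
Qed.

(** * The cost of a strategy *)

Section strategy_value.
Variable s : strategy R X Y.

Local Notation Z y := (LR f (hist s y)).
Local Notation act y := (chi s (hist s y)).
Local Notation sv y := (surv s (hist s y)).

(** Expectation under theta_1, for extended-valued functions of the observations; [Echi] takes real
    functions of the history. *)
Definition expect n (F : n.-tuple Y -> \bar R) : \bar R :=
  \int[powm mu n]_y (F y * (jdens f ord0 (hist s y))%:E).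

Let measurable_j n : measurable_fun setT (fun y : n.-tuple Y => (jdens f ord0 (hist s y))%:E).
Proof. by apply/measurable_EFinP; exact: measurable_jdens_hist. Qed.

Let j_ge0 n (y : n.-tuple Y) : 0 <= (jdens f ord0 (hist s y))%:E.
Proof. by rewrite lee_fin jdens_ge0. Qed.

Let measurable_mul_j n (F : n.-tuple Y -> \bar R) : measurable_fun setT F ->
  measurable_fun setT (fun y => F y * (jdens f ord0 (hist s y))%:E).
Proof. by move=> mF; apply: emeasurable_funM => //; exact: measurable_j. Qed.

Lemma expect_ge0 n (F : n.-tuple Y -> \bar R) : (forall y, 0 <= F y) -> 0 <= expect F.
Proof. by move=> F0; apply: integral_ge0 => y _; rewrite mule_ge0. Qed.

Lemma expectD n (F G : n.-tuple Y -> \bar R) :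
  measurable_fun setT F -> measurable_fun setT G ->
  (forall y, 0 <= F y) -> (forall y, 0 <= G y) ->
  expect (fun y => F y + G y) = expect F + expect G.
Proof.
move=> mF mG F0 G0; rewrite /expect -ge0_integralD//.
- by apply: eq_integral => y _; rewrite ge0_muleDl.
- by move=> y _; rewrite mule_ge0.
- exact: measurable_mul_j.
- by move=> y _; rewrite mule_ge0.
- exact: measurable_mul_j.
Qed.

Lemma expectZl n (c : R) (F : n.-tuple Y -> \bar R) :
  measurable_fun setT F -> (forall y, 0 <= F y) -> (0 <= c)%R ->
  expect (fun y => c%:E * F y) = c%:E * expect F.
Proof.
move=> mF F0 c0; rewrite /expect -ge0_integralZl//.
- by apply: eq_integral => y _; rewrite muleA.
- exact: measurable_mul_j.
- by move=> y _; rewrite mule_ge0.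
Qed.

Lemma le_expect n (F G : n.-tuple Y -> \bar R) :
  measurable_fun setT F -> measurable_fun setT G ->
  (forall y, 0 <= F y <= G y) -> expect F <= expect G.
Proof.
move=> mF mG FG; apply: ge0_le_integral => //.
- by move=> y _; have /andP[F0 _] := FG y; rewrite mule_ge0.
- exact: measurable_mul_j.
- exact: measurable_mul_j.
- by move=> y _; have /andP[_ FGy] := FG y; rewrite lee_wpmul2r.
Qed.

Lemma expectS n (F : n.+1.-tuple Y -> \bar R) :
  measurable_fun setT F -> (forall y, 0 <= F y) ->
  expect F = expect (fun y => \int[mu]_a (F (snoc (y, a)) * (f ord0 (act y) a)%:E)).
Proof.
move=> mF F0; rewrite /expect integral_powmS//; last 2 first.
- exact: measurable_mul_j.
- by move=> y; rewrite mule_ge0.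
apply: eq_integral => y _; rewrite -ge0_integralZr//.
- by apply: eq_integral => a _; rewrite jdens_snoc EFinM (muleC (jdens _ _ _)%:E) muleA.
- apply: emeasurable_funM.
    apply: (measurableT_comp mF (g := fun a => snoc (y, a))).
    exact: (measurableT_comp (measurable_snoc (n := n)) (measurable_pair1 y)).
  by apply/measurable_EFinP; exact: measurable_density.
- by move=> a _; rewrite mule_ge0// lee_fin.
Qed.

Lemma expect_tprefix n (F : n.-tuple Y -> \bar R) :
  measurable_fun setT F -> (forall y, 0 <= F y) ->
  expect (fun y => F (tprefix y)) = expect F.
Proof.
move=> mF F0; rewrite expectS//; last first.
  exact: (measurableT_comp mF (measurable_tprefix (n := n))).
apply: eq_integral => y _; congr (_ * _).
under eq_integral do rewrite tprefix_snoc.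
rewrite ge0_integralZl ?integral_f ?mule1//.
- by apply/measurable_EFinP; exact: measurable_density.
- by move=> a _; rewrite lee_fin.
Qed.

Section terminal.
Variable h : m.-tuple R -> \bar R.
Hypothesis measurable_h : measurable_fun nonneg h.
Hypothesis h_ge0 : forall z, nonneg z -> 0 <= h z.

Lemma measurable_LR_comp n : measurable_fun setT (fun y : n.-tuple Y => h (Z y)).
Proof.
apply: (measurable_nonneg_comp measurable_h (measurable_LR_hist measurable_f s (n := n))).
by move=> y; exact: nonneg_LR.
Qed.

Lemma measurable_step_act n : measurable_fun setT (fun y : n.-tuple Y => step h (Z y) (act y)).
Proof.
pose F (y : n.+1.-tuple Y) := (f ord0 (act (tprefix y)) (tnth y ord_max))%:E * h (Z y).
have -> : (fun y : n.-tuple Y => step h (Z y) (act y)) =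
    (fun y => \int[mu]_a F (snoc (y, a))).
  apply/funext => y; apply: eq_integral => a _.
  by rewrite /F tprefix_snoc tnth_rcons_ord_max LR_snoc.
apply: measurable_integral_snoc.
  apply: emeasurable_funM; last exact: measurable_LR_comp.
  apply/measurable_EFinP.
  apply: (measurableT_comp (measurable_f ord0)
    (g := fun y : n.+1.-tuple Y => (act (tprefix y), tnth y ord_max))).
  apply/measurable_fun_pairP; split; last exact: measurable_tnth.
  exact: (measurableT_comp (measurable_chi_hist s (n := n)) (measurable_tprefix (n := n))).
by move=> y; rewrite mule_ge0 ?lee_fin// h_ge0//; exact: nonneg_LR.
Qed.

(** The tower property: given the first n observations, the mean of h(Z_(n+1)) is [step h] at Z_n
    and the chosen control. *)
Lemma expect_step n :
  expect (fun y : n.+1.-tuple Y => (sv (tprefix y))%:E * h (Z y)) =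
  expect (fun y : n.-tuple Y => (sv y)%:E * step h (Z y) (act y)).
Proof.
rewrite expectS//; last 2 first.
- apply: emeasurable_funM; last exact: measurable_LR_comp.
  apply/measurable_EFinP.
  exact: (measurableT_comp (measurable_surv_hist s (n := n)) (measurable_tprefix (n := n))).
- by move=> y; rewrite mule_ge0 ?lee_fin ?surv_ge0// h_ge0//; exact: nonneg_LR.
apply: eq_integral => y _; congr (_ * _).
rewrite -ge0_integralZl ?lee_fin ?surv_ge0//.
- by apply: eq_integral => a _; rewrite tprefix_snoc LR_snoc -muleA (muleC (h _)).
- by apply: measurable_step_integrand => //; exact: nonneg_LR.
- by move=> a _; apply: step_integrand_ge0 => //; exact: nonneg_LR.
Qed.

End terminal.

(** Under theta_1 this is P(tau > n). Because [psi] is shifted by one, [stop_mass n] is P(tau =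
    n+1), and [stop_risk n] is the terminal risk incurred at stage n+1. *)
Definition surv_mass n : \bar R := expect (fun y : n.-tuple Y => (sv y)%:E).

Definition stop_mass n : \bar R :=
  expect (fun y : n.+1.-tuple Y => (stop s (hist s y))%:E).

Definition stop_risk n : \bar R :=
  expect (fun y : n.+1.-tuple Y => (stop s (hist s y))%:E * (g (Z y))%:E).

(* Together with [to_pay], a decomposition of the cost just before the control
   of stage [n.+1] is chosen: the observation of that stage is already paid,
   the decision after it is not. *)
Definition paid n : \bar R :=
  \sum_(0 <= k < n.+1) surv_mass k + \sum_(0 <= k < n) stop_risk k.

Definition to_pay h n : \bar R :=
  expect (fun y : n.-tuple Y => (sv y)%:E * step h (Z y) (act y)).

(** The cost still to come at the decision of stage n+1, once that stage is reached: either the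
    terminal risk, or one more observation followed by the continuation value [h]. *)
Definition stage_cost h n (y : n.+1.-tuple Y) : \bar R :=
  (psi s (hist s y))%:E * (g (Z y))%:E +
  (1 - psi s (hist s y))%:E * (1 + step h (Z y) (act y)).

Let measurable_gZ n : measurable_fun setT (fun y : n.-tuple Y => (g (Z y))%:E).
Proof. exact: (measurable_LR_comp measurable_g). Qed.

Let gZ_ge0 n (y : n.-tuple Y) : 0 <= (g (Z y))%:E.
Proof. by rewrite lee_fin g_ge0//; exact: nonneg_LR. Qed.

Let measurable_sv n : measurable_fun setT (fun y : n.-tuple Y => (sv y)%:E).
Proof. by apply/measurable_EFinP; exact: measurable_surv_hist. Qed.

Let measurable_sv_tprefix n : measurable_fun setT (fun y : n.+1.-tuple Y => (sv (tprefix y))%:E).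
Proof. exact: (measurableT_comp (measurable_sv (n := n)) (measurable_tprefix (n := n))). Qed.

Let sv_hist_ge0 n (y : n.-tuple Y) : 0 <= (sv y)%:E.
Proof. by rewrite lee_fin surv_ge0. Qed.

Let measurable_stop n : measurable_fun setT (fun y : n.+1.-tuple Y => (stop s (hist s y))%:E).
Proof. by apply/measurable_EFinP; exact: measurable_stop_hist. Qed.

Let stop_hist_ge0 n (y : n.+1.-tuple Y) : 0 <= (stop s (hist s y))%:E.
Proof. by rewrite lee_fin stop_ge0. Qed.

Let measurable_psi_EFin n : measurable_fun setT (fun y : n.+1.-tuple Y => (psi s (hist s y))%:E).
Proof. by apply/measurable_EFinP; exact: measurable_psi_hist. Qed.

Let psi_hist_ge0 n (y : n.+1.-tuple Y) : 0 <= (psi s (hist s y))%:E.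
Proof. by rewrite lee_fin psi_ge0. Qed.

Let measurable_one_sub_psi n :
  measurable_fun setT (fun y : n.+1.-tuple Y => (1 - psi s (hist s y))%:E).
Proof.
apply/measurable_EFinP; apply: measurable_funB; first exact: measurable_cst.
exact: measurable_psi_hist.
Qed.

Let one_sub_psi_ge0 n (y : n.+1.-tuple Y) : 0 <= (1 - psi s (hist s y))%:E.
Proof. by rewrite lee_fin subr_ge0 psi_le1. Qed.

Lemma surv_mass_ge0 n : 0 <= surv_mass n. Proof. exact: expect_ge0. Qed.

Lemma stop_mass_ge0 n : 0 <= stop_mass n. Proof. exact: expect_ge0. Qed.

Lemma stop_risk_ge0 n : 0 <= stop_risk n.
Proof. by apply: expect_ge0 => y; rewrite mule_ge0. Qed.

Lemma Echi_surv n : Echi mu f s ord0 (@surv _ _ _ _ _ s n) = surv_mass n.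
Proof. by apply: eq_integral => y _; rewrite EFinM. Qed.

Lemma surv_mass0 : surv_mass 0 = 1.
Proof.
rewrite /surv_mass /expect integral_powm0 /= ?jdens_nil ?mule1//.
by apply: emeasurable_funM; [exact: measurable_sv|exact: measurable_j].
Qed.

Lemma surv_mass_rec n : surv_mass n = stop_mass n + surv_mass n.+1.
Proof.
rewrite -expectD//.
rewrite [LHS]/surv_mass -(expect_tprefix (measurable_sv (n := n)))//.
by apply: eq_integral => y _; rewrite -EFinD stop_surv hprefix_hist.
Qed.

Lemma integral_stop_cost n :
  \int[powm mu n.+1]_y (stop s (hist s y) *
      (n.+1%:R * jdens f ord0 (hist s y) + lrisk f lambda (hist s y)))%:E =
  n.+1%:R%:E * stop_mass n + stop_risk n.
Proof.
rewrite -expectZl//.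
rewrite -expectD.
- apply: eq_integral => y _; rewrite lrisk_LR//.
  rewrite -!EFinM. congr EFin; ring.
- by apply: emeasurable_funM; [exact: measurable_cst|exact: measurable_stop].
- by apply: emeasurable_funM; [exact: measurable_stop|exact: measurable_gZ].
- by move=> y; rewrite mule_ge0.
- by move=> y; rewrite mule_ge0.
Qed.

Lemma to_pay_ge0 h n : (forall z, nonneg z -> 0 <= h z) -> 0 <= to_pay h n.
Proof.
by move=> h0; apply: expect_ge0 => y; rewrite mule_ge0// step_ge0//; exact: nonneg_LR.
Qed.

Lemma to_pay0 h : measurable_fun nonneg h -> (forall z, nonneg z -> 0 <= h z) ->
  to_pay h 0 = step h [tuple 1%R | r < m] (@chi _ _ _ _ _ s 0 ([tuple], [tuple])).
Proof.
move=> mh h0; rewrite /to_pay /expect integral_powm0 /= ?jdens_nil ?mule1 ?LR_nil ?mul1e//.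
apply: emeasurable_funM; last exact: measurable_j.
by apply: emeasurable_funM; [exact: measurable_sv|exact: measurable_step_act].
Qed.

Lemma measurable_stage_cost h n : measurable_fun nonneg h ->
  (forall z, nonneg z -> 0 <= h z) -> measurable_fun setT (@stage_cost h n).
Proof.
move=> mh h0; apply: emeasurable_funD.
  by apply: emeasurable_funM; [exact: measurable_psi_EFin|exact: measurable_gZ].
apply: emeasurable_funM; first exact: measurable_one_sub_psi.
by apply: emeasurable_funD; [exact: measurable_cst|exact: measurable_step_act].
Qed.

Lemma stage_cost_ge0 h n (y : n.+1.-tuple Y) :
  (forall z, nonneg z -> 0 <= h z) -> 0 <= stage_cost h y.
Proof.
move=> h0; rewrite adde_ge0// mule_ge0// adde_ge0// step_ge0//.
exact: nonneg_LR.
Qed.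

(** The survival weight before the decision splits into a stopping part and a surviving part, which
    yield the new terms of [paid] and the new [to_pay]. With [paid_to_pay], consecutive stages are
    compared through integrands on the same space. *)
Lemma paidS_to_pay h n : measurable_fun nonneg h -> (forall z, nonneg z -> 0 <= h z) ->
  paid n.+1 + to_pay h n.+1 =
  paid n + expect (fun y : n.+1.-tuple Y => (sv (tprefix y))%:E * stage_cost h y).
Proof.
move=> mh h0.
have mstep : measurable_fun setT
    (fun y : n.+1.-tuple Y => (sv y)%:E * step h (Z y) (act y)).
  by apply: emeasurable_funM; [exact: measurable_sv|exact: measurable_step_act].
have step0 (y : n.+1.-tuple Y) : 0 <= (sv y)%:E * step h (Z y) (act y).
  by rewrite mule_ge0// step_ge0//; exact: nonneg_LR.
have mstop : measurable_fun setT
    (fun y : n.+1.-tuple Y => (stop s (hist s y))%:E * (g (Z y))%:E).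
  by apply: emeasurable_funM; [exact: measurable_stop|exact: measurable_gZ].
have -> : expect (fun y : n.+1.-tuple Y => (sv (tprefix y))%:E * stage_cost h y) =
    stop_risk n + (surv_mass n.+1 + to_pay h n.+1).
  rewrite -expectD//.
  rewrite -expectD//.
  - apply: eq_integral => y _; congr (_ * _).
    rewrite /stage_cost ge0_muleDr; last 2 first.
    + by rewrite mule_ge0.
    + by rewrite mule_ge0// adde_ge0// step_ge0//; exact: nonneg_LR.
    rewrite !muleA -!EFinM /= /stop !hprefix_hist; congr (_ + _).
    by rewrite ge0_muleDr ?mule1// step_ge0//; exact: nonneg_LR.
  - by apply: emeasurable_funD => //; exact: measurable_sv.
  - by move=> y; rewrite mule_ge0.
  - by move=> y; rewrite adde_ge0.
have addE (a b c d t : \bar R) : ((a + b) + (c + d)) + t = (a + c) + (d + (b + t)).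
  by rewrite addeACA -!addeA (addeCA b).
rewrite /paid (big_nat_recr n.+1)//= [\sum_(0 <= k < n.+1) stop_risk k]big_nat_recr//.
exact: addE.
Qed.

Lemma paid_to_pay h n : measurable_fun nonneg h -> (forall z, nonneg z -> 0 <= h z) ->
  paid n + to_pay h n =
  paid n + expect (fun y : n.+1.-tuple Y => (sv (tprefix y))%:E * h (Z y)).
Proof. by move=> mh h0; rewrite expect_step. Qed.

Lemma surv_mass_le1 n : surv_mass n <= 1.
Proof.
elim: n => [|n]; first by rewrite surv_mass0.
by apply: le_trans; rewrite [leRHS]surv_mass_rec leeDr// stop_mass_ge0.
Qed.

(** An error [d] at one stage is weighted by the probability of reaching it, hence costs at most
    [d]. *)
Lemma paidS_to_pay_le h h' n (d : R) :
  measurable_fun nonneg h -> (forall z, nonneg z -> 0 <= h z) ->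
  measurable_fun nonneg h' -> (forall z, nonneg z -> 0 <= h' z) -> (0 <= d)%R ->
  (forall y : n.+1.-tuple Y, stage_cost h y <= h' (Z y) + d%:E) ->
  paid n.+1 + to_pay h n.+1 <= paid n + to_pay h' n + d%:E.
Proof.
move=> mh h0 mh' h'0 d0 le_stage.
rewrite (paidS_to_pay n mh h0) (paid_to_pay n mh' h'0).
rewrite -[leRHS]addeA leeD2l//.
have h'Z0 (y : n.+1.-tuple Y) : 0 <= h' (Z y) by apply: h'0; exact: nonneg_LR.
have mh'Z : measurable_fun setT (fun y : n.+1.-tuple Y => (sv (tprefix y))%:E * h' (Z y)).
  by apply: emeasurable_funM; [exact: measurable_sv_tprefix|exact: measurable_LR_comp].
have md : measurable_fun setT (fun y : n.+1.-tuple Y => d%:E * (sv (tprefix y))%:E).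
  by apply: emeasurable_funM; [exact: measurable_cst|exact: measurable_sv_tprefix].
have d0sv (y : n.+1.-tuple Y) : 0 <= d%:E * (sv (tprefix y))%:E by rewrite mule_ge0.
apply: le_trans (_ : expect (fun y : n.+1.-tuple Y =>
    (sv (tprefix y))%:E * h' (Z y) + d%:E * (sv (tprefix y))%:E) <= _).
  apply: le_expect.
  - by apply: emeasurable_funM; [exact: measurable_sv_tprefix|exact: measurable_stage_cost].
  - exact: emeasurable_funD.
  - move=> y; rewrite mule_ge0 ?stage_cost_ge0//= muleC (muleC d%:E).
    by rewrite -ge0_muleDr// [leLHS]muleC lee_wpmul2l.
have svh'0 (y : n.+1.-tuple Y) : 0 <= (sv (tprefix y))%:E * h' (Z y) by rewrite mule_ge0.
rewrite (expectD mh'Z md svh'0 d0sv) leeD2l//.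
rewrite (expectZl (@measurable_sv_tprefix n) (fun y => sv_hist_ge0 (tprefix y)) d0).
rewrite (expect_tprefix (measurable_sv (n := n)))// -[leRHS]mule1 lee_wpmul2l//.
exact: surv_mass_le1.
Qed.

(** * Convergence of the expected costs in the class F *)

Section in_class.
Hypothesis s_in : classF mu f s.

Lemma cvg_surv_mass : surv_mass n @[n --> \oo] --> 0.
Proof.
rewrite (_ : (fun n => _) = fun n => Echi mu f s ord0 (@surv _ _ _ _ _ s n)).
  exact: (s_in ord0).
by apply/funext => n; rewrite Echi_surv.
Qed.

(** The stopping masses sum to [surv_mass 0], as the survival masses tend to 0. This selects the
    finite-time branch of [Lcost]. *)
Lemma prob_tau_finE : prob_tau_fin mu f s ord0 = 1.
Proof.
rewrite -surv_mass0 (tail_sum stop_mass_ge0 surv_mass_rec cvg_surv_mass).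
by apply: eq_eseriesr => n _; apply: eq_integral => y _; rewrite EFinM.
Qed.

(** The linear bound in Z_n becomes, by the change of measure, a sum of survival probabilities under
    the other hypotheses. Membership in F makes these tend to 0. *)
Lemma to_pay_le h n : measurable_fun nonneg h ->
  (forall z, nonneg z -> 0 <= h z <= (g z)%:E) ->
  to_pay h n <= \sum_(r < m) C%:E * Echi mu f s (lift ord0 r) (@surv _ _ _ _ _ s n).
Proof.
move=> mh hg.
have h0 z : nonneg z -> 0 <= h z by move=> /hg/andP[].
have mJ r : measurable_fun setT
    (fun y : n.-tuple Y => (sv y * jdens f (lift ord0 r) (hist s y))%:E).
  apply/measurable_EFinP; apply: measurable_funM; first exact: measurable_surv_hist.
  exact: measurable_jdens_hist.
have J0 r (y : n.-tuple Y) : 0 <= (sv y * jdens f (lift ord0 r) (hist s y))%:E.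
  by rewrite lee_fin mulr_ge0 ?surv_ge0 ?jdens_ge0.
have C0 : (0 <= C)%R by exact: total_loss_ge0.
rewrite (_ : \sum_(r < m) _ = \int[powm mu n]_y
    \sum_(r < m) C%:E * (sv y * jdens f (lift ord0 r) (hist s y))%:E); last first.
  rewrite ge0_integral_sum//.
  - by apply: eq_bigr => r _; rewrite ge0_integralZl.
  - by move=> r; apply: emeasurable_funM.
  - by move=> r y _; rewrite mule_ge0.
apply: ge0_le_integral => //.
- by move=> y _; rewrite mule_ge0// mule_ge0// step_ge0//; exact: nonneg_LR.
- apply: measurable_mul_j; apply: emeasurable_funM; first exact: measurable_sv.
  exact: measurable_step_act.
- by apply: emeasurable_sum => r; apply: emeasurable_funM.
move=> y _; have Z0 := nonneg_LR f_ge0 (hist s y).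
apply: le_trans (_ : (sv y)%:E * (C * l1dist (Z y) zero_tuple)%:E *
    (jdens f ord0 (hist s y))%:E <= _).
  by rewrite lee_wpmul2r// lee_wpmul2l// step_le_l1dist.
rewrite l1dist0// -!EFinM; under [leRHS]eq_bigr do rewrite -EFinM.
rewrite sumEFin lee_fin.
rewrite [leRHS](eq_bigr (fun r => C * sv y * jdens f ord0 (hist s y) * tnth (Z y) r)%R).
  by rewrite -mulr_sumr le_eqVlt; apply/orP; left; apply/eqP; ring.
by move=> r _; rewrite -(LR_jdens f_supp); ring.
Qed.

Lemma cvg_to_pay (h_ : nat -> m.-tuple R -> \bar R) :
  (forall n, measurable_fun nonneg (h_ n)) ->
  (forall n z, nonneg z -> 0 <= h_ n z <= (g z)%:E) ->
  to_pay (h_ n) n @[n --> \oo] --> 0.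
Proof.
move=> mh hg; apply: (@squeeze_cvge _ _ _ _ (fun=> 0) _
  (fun n => \sum_(r < m) C%:E * Echi mu f s (lift ord0 r) (@surv _ _ _ _ _ s n))).
- apply: nearW => n; rewrite to_pay_le// ?andbT; last exact: hg.
  by apply: to_pay_ge0 => z /(hg n)/andP[].
- exact: cvg_cst.
rewrite [X in _ --> X](_ : 0 = \sum_(r < m) C%:E * 0); last first.
  by rewrite big1// => r _; rewrite mule0.
apply: cvg_nnesum => r _.
  apply: nearW => n; rewrite mule_ge0 ?lee_fin ?total_loss_ge0//.
  by apply: integral_ge0 => y _; rewrite lee_fin mulr_ge0 ?surv_ge0 ?jdens_ge0.
by apply: cvgeZl => //; exact: (s_in (lift ord0 r)).
Qed.

(** The survival masses sum to the expected number of observations and [to_pay] vanishes in the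
    limit. The continuation value may vary with [n], as truncated strategies require. *)
Lemma Lcost_cvg (h_ : nat -> m.-tuple R -> \bar R) :
  (forall n, measurable_fun nonneg (h_ n)) ->
  (forall n z, nonneg z -> 0 <= h_ n z <= (g z)%:E) ->
  paid n + to_pay (h_ n) n @[n --> \oo] --> Lcost mu f lambda s.
Proof.
move=> mh hg; rewrite /Lcost ifT; last by apply/asboolP; exact: prob_tau_finE.
rewrite (eq_eseriesr (g := fun n => n.+1%:R%:E * stop_mass n + stop_risk n)); last first.
  by move=> n _; exact: integral_stop_cost.
have v0 := surv_mass_ge0; have w0 := stop_risk_ge0.
rewrite nneseriesD//; last by move=> n _ _; rewrite mule_ge0// stop_mass_ge0.
rewrite (sum_tail_sum stop_mass_ge0 surv_mass_rec cvg_surv_mass).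
have sv_ge0 : 0 <= \sum_(0 <= k <oo) surv_mass k by apply: nneseries_ge0.
have w_ge0 : 0 <= \sum_(0 <= k <oo) stop_risk k by apply: nneseries_ge0.
rewrite -[X in _ --> X]adde0; apply: cvgeD; [by rewrite fin_num_adde_defl| |exact: cvg_to_pay].
apply: cvgeD; first by rewrite ge0_adde_def// inE.
  have : cvgn (fun n => \sum_(0 <= k < n) surv_mass k) by apply: is_cvg_nneseries.
  by move=> cv; rewrite (cvg_shiftS (fun n => \sum_(0 <= k < n) surv_mass k)).
by apply: is_cvg_nneseries.
Qed.

End in_class.

(** The law has density [jdens] with respect to [powm mu n], so a set is null for it exactly when
    the density vanishes almost everywhere on the set. *)
Lemma ae_lawP n (P : n.-tuple Y -> Prop) :
  {ae law mu f s ord0 (n := n), forall y, P y} <->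
  {ae powm mu n, forall y, jdens f ord0 (hist s y) != 0%R -> P y}.
Proof.
split=> [[A [mA A0 PA]]|[A [mA A0 PA]]].
  have mjA := measurable_funTS (D := A) (@measurable_j n).
  have /(ae_eq_integral_abs (powm mu n) mA mjA) :
      \int[powm mu n]_(y in A) `|(jdens f ord0 (hist s y))%:E| = 0.
    by rewrite -[RHS]A0; apply: eq_integral => y _; rewrite gee0_abs.
  apply: filterS => y jA j0; apply: contrapT => Py.
  by move/eqP: j0; apply; case: (jA (PA _ Py)).
pose B := A `|` [set y | jdens f ord0 (hist s y) = 0%R].
have mB : measurable B.
  apply: measurableU => //; rewrite -[X in measurable X]setTI.
  exact: (@measurable_jdens_hist _ _ _ _ _ _ _ measurable_f s ord0 n) measurableT
    [set 0%R] (measurable_set1 _).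
exists B; split => //.
  rewrite /law (ge0_ae_eq_integral (g := cst 0)) ?integral0//.
  - by apply: measurable_funTS; exact: measurable_j.
  - exists A; split => // y /= yB; apply: contrapT => nAy.
    by apply: yB => -[/nAy//|->].
move=> y /= Py; have [j0|j0] := eqVneq (jdens f ord0 (hist s y)) 0%R; first by right.
by left; apply: PA => /= /(_ j0).
Qed.

Lemma expect_ae_eq n (F G : n.-tuple Y -> \bar R) :
  measurable_fun setT F -> measurable_fun setT G ->
  (forall y, 0 <= F y) -> (forall y, 0 <= G y) ->
  {ae law mu f s ord0 (n := n), forall y, F y = G y} -> expect F = expect G.
Proof.
move=> mF mG F0 G0 /ae_lawP FG; apply: ge0_ae_eq_integral => //.
- exact: measurable_mul_j.
- exact: measurable_mul_j.
- by move=> y _; rewrite mule_ge0.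
- by move=> y _; rewrite mule_ge0.
apply: filterS FG => y FG _.
by have [->|/FG ->//] := eqVneq (jdens f ord0 (hist s y)) 0%R; rewrite !mule0.
Qed.

(** The nonnegative difference [G - F] has expectation 0; finiteness of [F] and of its expectation
    makes the subtractions legitimate. *)
Lemma expect_eq_ae n (F G : n.-tuple Y -> \bar R) :
  measurable_fun setT F -> measurable_fun setT G ->
  (forall y, 0 <= F y <= G y) -> (forall y, F y \is a fin_num) ->
  expect F \is a fin_num -> expect F = expect G ->
  {ae law mu f s ord0 (n := n), forall y, F y = G y}.
Proof.
move=> mF mG FG fF finF eqFG.
have F0 y : 0 <= F y by have /andP[] := FG y.
have mGF : measurable_fun setT (fun y => G y - F y) by exact: emeasurable_funB.
have GF0 y : 0 <= G y - F y by rewrite sube_ge0 ?fF//; have /andP[] := FG y.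
have : expect F + expect (fun y => G y - F y) = expect G.
  by rewrite -expectD//; apply: eq_integral => y _; rewrite addeC subeK.
rewrite -eqFG => /(congr1 (fun t => t - expect F)).
rewrite addeAC subee// add0e => GFint.
apply/ae_lawP.
have /(ae_eq_integral_abs (powm mu n) measurableT (measurable_mul_j mGF)) :
    \int[powm mu n]_y `|(G y - F y) * (jdens f ord0 (hist s y))%:E| = 0.
  by rewrite -[RHS]GFint; apply: eq_integral => y _; rewrite gee0_abs// mule_ge0.
apply: filterS => y /(_ I) /= /eqP; rewrite mule_eq0 eqe.
case/orP => [/eqP GFy|/eqP->]; last by rewrite eqxx.
by move=> _; rewrite -[RHS](@subeK _ _ (F y) (fF y)) GFy add0e.
Qed.

Let mrho := measurable_rho.
Let rho0 := rho_lim_ge0.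

Local Notation ones := [tuple 1%R | r < m].

Let nonneg_ones : nonneg ones.
Proof. by move=> r; rewrite tnth_mktuple. Qed.

Let psi01 n (y : n.+1.-tuple Y) : (0 <= psi s (hist s y) <= 1)%R.
Proof. by rewrite psi_ge0 psi_le1. Qed.

Lemma rho_le_stage_cost n (y : n.+1.-tuple Y) : rho (Z y) <= stage_cost rho y.
Proof. by apply: rho_le_randomized => //; exact: nonneg_LR. Qed.

(** The expectations of [before] and [after] are what is added to [paid n] to give the values of
    [paid + to_pay rho] at n and at n+1. *)
Let before n (y : n.+1.-tuple Y) := (sv (tprefix y))%:E * rho (Z y).
Let after n (y : n.+1.-tuple Y) := (sv (tprefix y))%:E * stage_cost rho y.

Let measurable_before n : measurable_fun setT (@before n).
Proof. by apply: emeasurable_funM; [exact: measurable_sv_tprefix|exact: measurable_LR_comp]. Qed.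

Let measurable_after n : measurable_fun setT (@after n).
Proof. by apply: emeasurable_funM; [exact: measurable_sv_tprefix|exact: measurable_stage_cost]. Qed.

Let before_after n (y : n.+1.-tuple Y) : 0 <= before y <= after y.
Proof.
rewrite mule_ge0 ?rho0//=; last exact: nonneg_LR.
by rewrite lee_wpmul2l// rho_le_stage_cost.
Qed.

Let after_ge0 n (y : n.+1.-tuple Y) : 0 <= after y.
Proof. by have /andP[+ +] := before_after y; exact: le_trans. Qed.

Lemma paid_to_pay_nondecreasing : nondecreasing_seq (fun n => paid n + to_pay rho n).
Proof.
apply/nondecreasing_seqP => n; rewrite paid_to_pay// paidS_to_pay// leeD2l//.
by apply: (le_expect (@measurable_before n) (@measurable_after n)); exact: before_after.
Qed.

Lemma paid_to_pay0 : paid 0 + to_pay rho 0 =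
  1 + step rho ones (@chi _ _ _ _ _ s 0 ([tuple], [tuple])).
Proof. by rewrite to_pay0// /paid big_nat1 big_nil adde0 surv_mass0. Qed.

Lemma ge_paid_to_pay0 : 1 + Rfun ones <= paid 0 + to_pay rho 0.
Proof. by rewrite paid_to_pay0 leeD2l// min_ctrl_le. Qed.

(** Pointwise, where the stage is not reached both sides are trivial; elsewhere the survival weight
    cancels and the equality case of the randomised inequality gives (a) at stage n+1 together with
    (b) after it. *)
Lemma cond_abP :
  (forall n, {ae law mu f s ord0 (n := n.+1), forall y, before y = after y}) <->
  cond_a mu f lambda s /\ cond_b mu f lambda s.
Proof.
have key n (y : n.+1.-tuple Y) : before y = after y <->
    ((0 < sv (tprefix y))%R ->
     (\1_[set v : n.+1.-tuple Y | ((g (Z v))%:E < 1 + Rfun (Z v))%E] y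
       <= psi s (hist s y)
       <= \1_[set v : n.+1.-tuple Y | ((g (Z v))%:E <= 1 + Rfun (Z v))%E] y)%R)
    /\ ((0 < sv y)%R -> step rho (Z y) (act y) = Rfun (Z y)).
  have Z0 := nonneg_LR f_ge0 (hist s y).
  have svE : sv y = (sv (tprefix y) * (1 - psi s (hist s y)))%R.
    by rewrite /= hprefix_hist.
  have indicP (b : n.+1.-tuple Y -> bool) :
      \1_[set v | b v] y = (b y)%:R :> R.
    by rewrite indicE; congr (_%:R); congr nat_of_bool; apply/idP/idP; rewrite inE.
  rewrite !indicP.
  (* Survival past the decision means reaching it and not stopping surely: the proviso under which
     the control has to be optimal. *)
  have -> : ((0 < sv y) = (0 < sv (tprefix y)) && (psi s (hist s y) < 1))%R.
    rewrite svE; have [->|svn0] := eqVneq (sv (tprefix y)) 0%R; first by rewrite mul0r ltxx.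
    have sv_gt0 : (0 < sv (tprefix y))%R by rewrite lt_neqAle eq_sym svn0 surv_ge0.
    by rewrite pmulr_rgt0// subr_gt0 sv_gt0.
  have [svp0|svn0] := eqVneq (sv (tprefix y)) 0%R.
    by rewrite /before /after svp0 !mul0e ltxx; split.
  have sv_gt0 : (0 < sv (tprefix y))%R by rewrite lt_neqAle eq_sym svn0 surv_ge0.
  rewrite sv_gt0 /=; split.
    move=> eqy; have : rho (Z y) = stage_cost rho y.
      apply/eqP; rewrite eq_le rho_le_stage_cost /=.
      have : after y <= before y by rewrite eqy.
      by rewrite /before /after lee_pmul2l// lte_fin.
    move/(rho_eq_randomized (act y) Z0 (psi01 y)) => [h1 h2 h3].
    by split => // _; apply/stop_between.
  move=> [/(_ isT)/(stop_between _ _ (psi01 y))[h1 h2] h3].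
  congr (_ * _); apply/(rho_eq_randomized (act y) Z0 (psi01 y)).
  by split.
split=> [H|[Ha Hb] n].
  split=> [n|[//|n] _]; apply/ae_lawP; move/ae_lawP: (H n); apply: filterS => y h j0.
    by have /key[] := h j0.
  by have /key[_] := h j0.
apply/ae_lawP; move/ae_lawP: (Ha n) => Han; move/ae_lawP: (Hb n.+1 isT) => Hbn.
by apply: filterS2 Han Hbn => y ha hb j0; apply/key; split; [exact: ha|exact: hb].
Qed.

Section optimality.
Hypothesis s_in : classF mu f s.

Lemma paid_to_pay_le_Lcost n : paid n + to_pay rho n <= Lcost mu f lambda s.
Proof.
apply: (cvge_to_ge (Lcost_cvg s_in (fun=> mrho) (fun=> rho_bounds))).
by exists n => // k /= nk; exact: paid_to_pay_nondecreasing.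
Qed.

Lemma Lcost_ge : 1 + Rfun ones <= Lcost mu f lambda s.
Proof. exact: le_trans ge_paid_to_pay0 (paid_to_pay_le_Lcost 0). Qed.

(** The values [paid n + to_pay rho n] increase from at least [1 + Rfun ones] to the cost. Equality
    of the ends makes all of them equal; conversely (a), (b) and (c) make the sequence constant. *)
Lemma Lcost_minimalP : Lcost mu f lambda s = 1 + Rfun ones <->
  [/\ cond_a mu f lambda s, cond_b mu f lambda s & cond_c mu f lambda s].
Proof.
split=> [LE|[Ha Hb Hc]].
  have AE n : paid n + to_pay rho n = 1 + Rfun ones.
    apply/eqP; rewrite eq_le -[X in _ <= X]LE paid_to_pay_le_Lcost /=.
    apply: le_trans ge_paid_to_pay0 _; exact: paid_to_pay_nondecreasing.
  have finA n : paid n + to_pay rho n \is a fin_num by rewrite AE fin_numD Rfun_fin_num.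
  have [Ha Hb] : cond_a mu f lambda s /\ cond_b mu f lambda s.
    apply/cond_abP => n.
    have := finA n; rewrite paid_to_pay// fin_numD => /andP[fin_paid fin_before].
    apply: expect_eq_ae => //.
    - move=> y; rewrite fin_numM// rho_fin_num//; exact: nonneg_LR.
    - have : paid n + expect (@before n) = paid n + expect (@after n).
        by rewrite -paid_to_pay// -paidS_to_pay// !AE.
      move/(congr1 (fun t => t - paid n)).
      by rewrite !(addeC (paid n)) !addeK.
  split => //; rewrite /cond_c.
  have := AE 0%N; rewrite paid_to_pay0 => /(congr1 (fun t => t - 1)).
  by rewrite !(addeC 1) !addeK.
have AE n : paid n + to_pay rho n = 1 + Rfun ones.
  elim: n => [|n IHn]; first by rewrite paid_to_pay0 Hc.
  rewrite -IHn paidS_to_pay// paid_to_pay//; congr (_ + _); apply/esym.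
  apply: expect_ae_eq => //.
  - by move=> y; have /andP[] := before_after y.
  - exact: after_ge0.
  - exact: (cond_abP.2 (conj Ha Hb) n).
have := Lcost_cvg s_in (fun=> mrho) (fun=> rho_bounds).
rewrite (_ : (fun n => _) = cst (1 + Rfun ones)); last exact/funext.
by move=> /cvg_lim <-//; rewrite lim_cst.
Qed.

End optimality.
End strategy_value.

(** * Truncated strategies *)

Section truncated_strategy.
Variables (N : nat) (delta : R) (sel : nat -> m.-tuple R -> X).
Hypothesis delta_ge0 : (0 <= delta)%R.
Hypothesis measurable_sel : forall n, measurable_fun setT (sel n).
Hypothesis sel_near_optimal : forall n z, nonneg z ->
  step (rho_ n) z (sel n z) <= min_ctrl (step (rho_ n) z) + delta%:E.

(** For n >= N the index [N - n] is 0 and [rho_ 0] is [g], so every history stops: the strategy ends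
    by stage N+1. *)
Let stopset n : set (history X Y n.+1) :=
  [set hst | (g (LR f hst))%:E <= rho_ (N - n) (LR f hst)].

Let measurable_stopset n : measurable (@stopset n).
Proof.
have mLR := measurable_LR measurable_f (n := n.+1).
have LR0 (hst : history X Y n.+1) : nonneg (LR f hst) by exact: nonneg_LR.
rewrite -[X in measurable X]setTI; apply: measurable_lee => //.
- exact: (measurable_nonneg_comp measurable_g mLR LR0).
- exact: (measurable_nonneg_comp (measurable_rho_ (N - n)) mLR LR0).
Qed.

Let truncated_chi n (hst : history X Y n) : X := sel (N - n) (LR f hst).

Let truncated_psi n (hst : history X Y n.+1) : R := \1_(@stopset n) hst.

Let measurable_truncated_chi n : measurable_fun setT (@truncated_chi n).
Proof.
exact: (measurableT_comp (@measurable_sel (N - n)) (measurable_LR measurable_f (n := n))).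
Qed.

Let measurable_truncated_psi n : measurable_fun setT (@truncated_psi n).
Proof. by apply: measurable_indic; exact: measurable_stopset. Qed.

Let truncated_psi_ge0 n (hst : history X Y n.+1) : (0 <= truncated_psi hst)%R.
Proof. by rewrite /truncated_psi indicE. Qed.

Let truncated_psi_le1 n (hst : history X Y n.+1) : (truncated_psi hst <= 1)%R.
Proof. by rewrite /truncated_psi indicE; case: (_ \in _). Qed.

Definition truncated : strategy R X Y :=
  Strategy measurable_truncated_chi measurable_truncated_psi
    truncated_psi_ge0 truncated_psi_le1.

Lemma surv_truncated n (hst : history X Y n) : (N < n)%N -> surv truncated hst = 0%R.
Proof.
case: n hst => // n hst; rewrite ltnS -subn_eq0 => /eqP Nn /=.
rewrite /truncated_psi indicE mem_set ?subrr ?mulr0//.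
by rewrite /stopset /= Nn.
Qed.

Lemma truncated_in_class : classF mu f truncated.
Proof.
move=> i; apply: (@cvg_near_cst _ _ _ _ _); exists N.+1 => // n /= Nn.
by apply: integral0_eq => y _; rewrite surv_truncated// mul0r.
Qed.

(* With [N - n] stages left, [rho_ (N - n)] replaces [rho]: truncation puts the
   strategy in the class for every hypothesis at once. *)
Lemma stage_cost_truncated n (y : n.+1.-tuple Y) :
  stage_cost truncated (rho_ (N - n.+1)) y <=
  rho_ (N - n) (LR f (hist truncated y)) + (if (n < N)%N then delta else 0%R)%:E.
Proof.
set z := LR f (hist truncated y); have z0 : nonneg z by exact: nonneg_LR.
have d0 : 0 <= (if (n < N)%N then delta else 0%R)%:E by case: ifP; rewrite lee_fin.
rewrite /stage_cost /= /truncated_psi indicE -/z.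
have [gle|nle] := pselect (stopset (hist truncated y)).
  rewrite mem_set// subrr mul0e adde0 mul1e.
  by apply: (le_trans gle); rewrite leeDl.
rewrite memNset// subr0 mul0e add0e mul1e.
have nN : (n < N)%N.
  by rewrite ltnNge -subn_eq0; apply/negP => /eqP Nn; apply: nle; rewrite /stopset /= Nn.
(* Off the stopping set the minimum in the recursion is its continuation term, which the selector
   attains up to [delta]. *)
rewrite nN; move: nle; rewrite /stopset /= -/z -(subnSK nN) /= le_min lexx /=.
move=> /negP; rewrite -ltNge => Rlt.
rewrite min_r ?(ltW Rlt)// -addeA leeD2l//.
exact: sel_near_optimal.
Qed.

Local Notation ones := [tuple 1%R | r < m].

(** One [delta] is lost on the first control and one on each later control chosen before the
    horizon; after [N] nothing more is lost. *)
Lemma paid_to_pay_truncated n :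
  paid truncated n + to_pay truncated (rho_ (N - n)) n <=
  1 + min_ctrl (step (rho_ N) ones) + ((minn n N).+1%:R * delta)%:E.
Proof.
have mr k := measurable_rho_ k; have r0 k z := @rho_ge0 k z.
elim: n => [|n IHn].
  rewrite subn0 (@to_pay0 _ _ (mr N) (r0 N)) /paid big_nat1 big_nil.
  rewrite adde0 surv_mass0 min0n mul1r -addeA leeD2l//.
  rewrite /= /truncated_chi subn0 LR_nil; apply: sel_near_optimal.
  by move=> r; rewrite tnth_mktuple.
pose d : R := if (n < N)%N then delta else 0%R.
have d0 : (0 <= d)%R by rewrite /d; case: ifP.
apply: le_trans (paidS_to_pay_le (mr _) (r0 _) (mr _) (r0 _) d0
  (@stage_cost_truncated n)) _.
apply: le_trans (leeD2r _ IHn) _; rewrite -addeA leeD2l// -EFinD lee_fin /d.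
have [nN|] := boolP (n < N)%N.
  by rewrite (minn_idPl (ltnW nN)) (minn_idPl nN) -[n.+2%:R]natr1; lra.
rewrite -leqNgt => Nn.
by rewrite (minn_idPr Nn) (minn_idPr (leqW Nn)) addr0.
Qed.

Lemma Lcost_truncated :
  Lcost mu f lambda truncated <= 1 + min_ctrl (step (rho_ N) ones) + (N.+1%:R * delta)%:E.
Proof.
have bounds n z : nonneg z -> 0 <= rho_ (N - n) z <= (g z)%:E.
  by move=> z0; rewrite rho_ge0// rho_le_g.
apply: (cvge_to_le (Lcost_cvg truncated_in_class
  (fun n => measurable_rho_ (N - n)) bounds)).
apply: nearW => n; apply: le_trans (paid_to_pay_truncated n) _.
by rewrite leeD2l// lee_fin ler_wpM2r// ler_nat ltnS geq_minr.
Qed.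

End truncated_strategy.

Lemma Lcost_inf_le :
  ereal_inf [set Lcost mu f lambda t | t in classF mu f] <= 1 + Rfun [tuple 1%R | r < m].
Proof.
have ones0 : nonneg [tuple 1%R | r < m] by move=> r; rewrite tnth_mktuple.
apply/lee_addgt0Pr => e e0.
have [N RN] : exists N, min_ctrl (step (rho_ N) [tuple 1%R | r < m]) <=
    Rfun [tuple 1%R | r < m] + (e / 2)%:E.
  apply: contrapT => noN.
  have : Rfun [tuple 1%R | r < m] + (e / 2)%:E <= Rfun [tuple 1%R | r < m].
    apply: (cvge_to_ge (cvg_min_ctrl_step_rho ones0)); apply: nearW => N.
    by rewrite leNgt; apply/negP => /ltW ltN; apply: noN; exists N.
  by rewrite -(fineK (Rfun_fin_num ones0)) -EFinD lee_fin; lra.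
(* Half of [e] was spent on replacing [rho] by [rho_ N]; the other half is shared among the N+1
   selections. *)
pose delta : R := (e / 2 / N.+1%:R)%R.
have delta0 : (0 < delta)%R by rewrite !divr_gt0.
have /choice[sel selP] n : exists sel : m.-tuple R -> X, measurable_fun setT sel /\
    forall z, nonneg z -> step (rho_ n) z (sel z) <= min_ctrl (step (rho_ n) z) + delta%:E.
  have [att _ _ _] := minima.
  have [|//|x|z|sel msel selP] := @near_optimal_selector C (step (rho_ n)) delta.
  - exact: total_loss_ge0.
  - by apply: step_lipschitz; [exact: measurable_rho_|exact: rho_ge0|exact: rho_lipschitz].
  - exact: att.
  by exists sel.
have msel n := proj1 (selP n); have osel n := proj2 (selP n).
apply: le_trans (_ : Lcost mu f lambda (truncated N msel) <= _).
  by apply: ereal_inf_lbound; exists (truncated N msel) => //; exact: truncated_in_class.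
apply: le_trans (Lcost_truncated N (ltW delta0) msel osel) _.
rewrite -!addeA leeD2l//; apply: le_trans (leeD2r _ RN) _.
rewrite -addeA leeD2l// -EFinD lee_fin /delta (mulrC N.+1%:R) divfK ?pnatr_eq0//.
by rewrite -splitr.
Qed.

Lemma optimalP s : classF mu f s ->
  optimal mu f lambda s <-> Lcost mu f lambda s = 1 + Rfun [tuple 1%R | r < m].
Proof.
move=> s_in.
have inf_eq : ereal_inf [set Lcost mu f lambda t | t in classF mu f] =
    1 + Rfun [tuple 1%R | r < m].
  apply/eqP; rewrite eq_le Lcost_inf_le /=.
  by apply: le_ereal_inf_tmp => _ [t t_in <-]; exact: Lcost_ge.
by rewrite /optimal inf_eq.
Qed.

End dynamic_programming.

(** * The characterisation of optimal strategies *)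

Theorem theorem7 (R : realType) (dX dY : measure_display)
  (X : measurableType dX) (Y : measurableType dY)
  (mu : {sigma_finite_measure set Y -> \bar R})
  (m : nat) (k_ge2 : (2 <= m.+1)%N)
  (f : 'I_m.+1 -> X -> Y -> R)
  (f_density : forall i, is_density mu (f i))
  (lambda : 'I_m.+1 -> 'I_m.+1 -> R)
  (lambda_ge0 : forall i j : 'I_m.+1, i != j -> 0 <= lambda i j)
  (minima : minima_well_defined mu f lambda)
  (f_supp : forall x : X,
    [set y | f ord0 x y = 0]
      `<=` \bigcap_(i in [set i : 'I_m.+1 | i != ord0]) [set y | f i x y = 0]) :
  (forall s : strategy R X Y,
    classF mu f s -> optimal mu f lambda s ->
    [/\ cond_a mu f lambda s, cond_b mu f lambda s & cond_c mu f lambda s]) /\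
  (forall s : strategy R X Y,
    cond_a mu f lambda s -> cond_b mu f lambda s -> cond_c mu f lambda s ->
    classF mu f s -> optimal mu f lambda s).
Proof.
have f_ge0 i x y : 0 <= f i x y by case: (f_density i) => _ + _; exact.
have measurable_f i : measurable_fun setT (fun xy : X * Y => f i xy.1 xy.2).
  by case: (f_density i).
have integral_f i x : (\int[mu]_y (f i x y)%:E = 1)%E.
  by case: (f_density i) => _ _; exact.
split=> [s s_in|s Ha Hb Hc s_in].
  move=> /(optimalP f_ge0 measurable_f integral_f lambda_ge0 f_supp minima s_in).
  by move=> /(Lcost_minimalP f_ge0 measurable_f integral_f lambda_ge0 f_supp minima s_in).
apply/(optimalP f_ge0 measurable_f integral_f lambda_ge0 f_supp minima s_in).
by apply/(Lcost_minimalP f_ge0 measurable_f integral_f lambda_ge0 f_supp minima s_in).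
Qed.
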